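(* The following bounds hold: (1) $\frac{n^{3/4}}{(\log n)^{3/2}}\ll F_{12,3}(n)-\left(\pi(n)+\pi(\frac n2)+\pi(\frac n3)\right)\ll n^{5/6}$; (2) $\frac{n^{3/4}}{(\log n)^{3/2}}\ll F_{15,3}(n)-\left(\pi(n)+\pi(\frac n2)+\pi(\frac n3)+\pi(\frac n5)\right)\ll n^{5/6}$; (3) $\frac{n^{2/3}}{(\log n)^{4/3}}\ll F_{18,3}(n)-\left(\pi(n)+\pi(\frac n2)\right)\ll n^{5/6}$; (4) $\frac{n^{2/3}}{(\log n)^{4/3}}\ll F_{21,3}(n)-\left(\pi(n)+\pi(\frac n2)+\pi(\frac n3)\right)\ll n^{5/6}$; (5) $\frac{n^{3/5}}{(\log n)^{6/5}}\ll F_{24,3}(n)-\left(\pi(n)+\pi(\frac n2)+\pi(\frac n3)\right)\ll n^{5/6}$; (6) $\frac{n^{3/5}}{(\log n)^{6/5}}\ll F_{27,3}(n)-\left(\pi(n)+\pi(\frac n2)\right)\ll n^{5/6}$; (7) $\frac{n^{3/5}}{(\log n)^{6/5}}\ll F_{30,3}(n)-\left(\pi(n)+\pi(\frac n2)+\pi(\frac n3)\right)\ll n^{5/6}$; (8) $\frac{n^{3/5}}{(\log n)^{6/5}}\ll F_{33,3}(n)-\left(\pi(n)+\pi(\frac n2)+\pi(\frac n3)\right)\ll n^{5/6}$.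
   Context: $\log$ is the natural logarithm, $\pi(x)$ is the number of primes not exceeding $x$. $X\ll Y$ means there is an absolute constant $c>0$ with $X\le cY$ for all sufficiently large $n$. $F_{k,d}(n)$ is the maximal size of a set $A\subseteq\{1,\dots,n\}$ such that the equation $a_1a_2\cdots a_k=x^d$ with $a_1<a_2<\dots<a_k$ has no solution with $a_1,\dots,a_k\in A$ and $x$ an integer. *)

(* Defs.v *)
From mathcomp Require Import all_boot all_order all_algebra.
From mathcomp Require Import all_classical all_reals all_analysis.

Set Implicit Arguments.
Unset Strict Implicit.
Unset Printing Implicit Defensive.

Local Open Scope classical_set_scope.
Local Open Scope ring_scope.

(* Subsets of {1, ..., n} are encoded as A : {set 'I_n.+1} with
   ord0 \notin A; see Fmax. *)
Definition no_power_product (k d n : nat) (A : {set 'I_n.+1}) : Prop :=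
  ~ exists (a : k.-tuple 'I_n.+1) (x : int),
      [/\ {subset a <= A},
          forall i j : 'I_k, (i < j)%N -> (tnth a i < tnth a j)%N &
          \prod_(i < k) (tnth a i)%:Z = x ^+ d].

(* For k > 0 the empty set is admissible, so this is the maximum of a
   nonempty family. *)
Definition Fmax (k d n : nat) : nat :=
  (\max_(A : {set 'I_n.+1} | (ord0 \notin A) && `[< no_power_product k d A >])
     #|A|)%N.

(* For x >= 0, Num.truncn x is the integer part of x. *)
Definition prime_pi {R : realType} (x : R) : nat :=
  count prime (iota 0 (Num.truncn x).+1).

(* X << Y in Vinogradov's notation; no absolute values are taken. *)
Definition vinogradov_le {R : realType} (X Y : nat -> R) : Prop :=
  exists2 c : R, 0 < c & \forall n \near \oo, X n <= c * Y n.

(* Main.v *)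
(* Write k = 3m.

   Upper bound. Let n < T^6. Writing a = u v with v the largest divisor of a not
   exceeding T^3, either u <= T^5, or u is a prime larger than T^5 and v < T.
   View A as the bipartite graph of the pairs (u, v). If distinct x_1, ..., x_m
   are joined to triples of vertices among distinct y_1, ..., y_w so that each y_j is
   used a multiple of 3 times, the 3m products multiply to a cube. Dependent random
   choice, with a geometric sum over the size of u, shows that a graph without
   such a configuration has O(T^5) edges with u <= T^5. For primes u > T^5, each
   w-subset of [1, T) lies in fewer than m neighbourhoods, so the excess of the
   degrees of these u over min(w - 1, n / u) sums to O(T^w); here w = 3 if 3 | m,
   w = 5 if m = 5, and w = 4 otherwise.

   Lower bound. Take the multiples i p, for i in {1, 2}, {1, 2, 3} or {1, 2, 3, 5},
   of the primes p > s = floor (sqrt n), and add the products of adjacent vertices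
   in a bipartite graph whose vertices are labelled by distinct primes in (5, s].
   In a product that is a cube all vertex degrees are divisible by 3, so girth 6
   forces at least 18 and girth 8 at least 36 edges, more than k = 12, 15 and
   k <= 33 respectively. So only multiples i p are used, at least three for each p
   that occurs, hence each i at most m times in all; this is incompatible with the
   number of uses of 2, 3 and 5 being divisible by 3. Graphs over F_q with q a power of 2 provide N^(3/2) and
   N^(4/3) edges on N vertices up to constants, where N is of order at least
   sqrt n / log n by Chebyshev's bound. *)
Require Import Defs.
From mathcomp Require Import all_boot all_order all_algebra.
From mathcomp Require Import finfield.
From mathcomp Require Import zify ring lra.

Set Implicit Arguments.
Unset Strict Implicit.
Unset Printing Implicit Defensive.

(** * Dependent random choice *)

(* If x_i is adjacent to y_j for all j in the i-th triple of t, then the product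
   of the 3m numbers x_i y_j is a cube: each y_j occurs a multiple of 3 times. *)
Definition design (m w : nat) (t : seq (seq nat)) : bool :=
  [&& size t == m,
      all (fun s => [&& size s == 3, uniq s & all (gtn w) s]) t &
      all (fun j => 3 %| count (fun s => j \in s) t) (iota 0 w)].

(** A copy of the incidence pattern t in the graph N, injective on both sides. Only the values of x
    below [size t] and of y below w matter. *)
Definition realizes (X Y : finType) (N : X -> {set Y}) (P : {set X})
    (w : nat) (t : seq (seq nat)) (x : nat -> X) (y : nat -> Y) : Prop :=
  [/\ {in gtn (size t) &, injective x},
      {in gtn w &, injective y},
      forall i, i < size t -> x i \in P &
      forall i j, i < size t -> j \in nth [::] t i -> y j \in N (x i)].

(** Greedy choice: when the element for index k is chosen, only k < m elements are taken, and [F k]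
    has at least m. *)
Lemma distinct_representatives (X : finType) (x0 : X) (m : nat)
    (F : nat -> {set X}) :
  (forall i, i < m -> m <= #|F i|) ->
  exists x : nat -> X,
    {in gtn m &, injective x} /\ forall i, i < m -> x i \in F i.
Proof.
move=> Fm.
suff /(_ m (leqnn m)) [s [sz us Fs]]: forall k, k <= m ->
    exists s, [/\ size s = k, uniq s & forall i, i < k -> nth x0 s i \in F i].
  exists (nth x0 s); split=> // i j; rewrite !inE => im jm /eqP.
  by rewrite nth_uniq ?sz // => /eqP.
elim=> [|k IHk] km; first by exists [::].
have [s [sz us Fs]] := IHk (ltnW km).
have [z zF zs] : exists2 z, z \in F k & z \notin s.
  apply/subsetPn/negP => /subset_leq_card/leq_trans/(_ (card_size s)).
  by rewrite leqNgt sz (leq_trans km) ?Fm.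
exists (rcons s z); split=> [||i].
- by rewrite size_rcons sz.
- by rewrite rcons_uniq zs.
rewrite ltnS leq_eqVlt nth_rcons sz => /orP[/eqP ->|ik].
  by rewrite ltnn eqxx.
by rewrite ik Fs.
Qed.

Lemma leq_card_cover (T I : finType) (A : {set T}) (J : {set I})
    (B : I -> {set T}) (c : nat) :
  (forall a, a \in A -> exists2 i, i \in J & a \in B i) ->
  (forall i, i \in J -> #|B i| <= c) -> #|A| <= #|J| * c.
Proof.
move=> AB Bc.
have /subset_leq_card/leq_trans -> // : A \subset \bigcup_(i in J) B i.
  by apply/subsetP => a /AB[i iJ aB]; apply/bigcupP; exists i.
rewrite -sum_nat_const; apply: (@leq_trans (\sum_(i in J) #|B i|)).
  elim/big_rec2: _ => [|i k C _ IH]; first by rewrite cards0.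
  by rewrite (leq_trans (leq_card_setU _ _)) ?leq_add2l.
exact: leq_sum.
Qed.

(** Each coordinate fixed on J removes one factor. It is applied to collisions (two coordinates
    fixed) and to poor triples (three). *)
Lemma card_ffun_prescribed (Y I : finType) (N : {set Y}) (J : {set I})
    (g : I -> Y) :
  #|[set f : {ffun I -> Y} | [forall i, f i \in N]
       && [forall i in J, f i == g i]]| <= #|N| ^ (#|I| - #|J|).
Proof.
pose F i : {pred Y} := if i \in J then pred1 (g i) else mem N.
apply: (@leq_trans #|family F|).
  apply/subset_leq_card/subsetP => f; rewrite inE => /andP[/forallP fN].
  move=> /forall_inP fg; apply/familyP => i; rewrite /F.
  by case: ifP => [/fg|_] //; apply: fN.
rewrite card_family foldrE big_map big_enum /= (bigID (mem J)) /=.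
rewrite big1 => [|i iJ]; last by rewrite /F iJ card1.
rewrite mul1n (eq_bigr (fun=> #|N|)) => [|i /negPf iJ]; last first.
  by rewrite /F iJ.
rewrite (eq_bigl (mem (~: J))) => [|i]; last by rewrite !inE.
by rewrite prod_nat_const (cardsCs (~: J)) setCK.
Qed.

(* Choosing a random x favours those triples of Y that have many common
   neighbours: a w-tuple of neighbours of x without repetitions whose triples
   prescribed by t all have at least m common neighbours yields a realization. *)
Section DependentRandomChoice.

Variables (X Y : finType) (N : X -> {set Y}) (P : {set X}) (Y0 : {set Y}).
Variables (m w : nat) (t : seq (seq nat)).
Hypotheses (w_ge3 : 2 < w) (tP : design m w t).

Let common (s : Y * Y * Y) :=
  [set x in P | [&& s.1.1 \in N x, s.1.2 \in N x & s.2 \in N x]].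

Let poor x := [set s : Y * Y * Y |
  [&& s.1.1 \in N x, s.1.2 \in N x & s.2 \in N x] && (#|common s| < m)].

(** Double counting: a poor triple that is counted lies in the cube of Y0, and it is counted only by
    its common neighbours in P, fewer than m of them. *)
Let sum_poor : (forall x, x \in P -> N x \subset Y0) ->
  \sum_(x in P) #|poor x| <= m * #|Y0| ^ 3.
Proof.
move=> NY; under eq_bigr do rewrite -sum1dep_card big_mkcond /=.
rewrite exchange_big /= -[3]/(1 + 1 + 1) !expnD !expn1 -!cardsX mulnC.
rewrite -sum_nat_const [leqLHS](bigID (mem (setX (setX Y0 Y0) Y0))) /=.
rewrite [X in _ + X]big1 ?addn0 => [|s sY]; last first.
  apply: big1 => x xP; case: ifP => // /andP[/and3P[h1 h2 h3] _].
  case/negP: sY; rewrite !inE.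
  by rewrite !(subsetP (NY x xP)).
apply: leq_sum => s _.
have [sm|] := ltnP #|common s| m; last first.
  move=> sm; rewrite big1 // => x xP.
  by rewrite andbF.
rewrite -big_mkcondr sum1dep_card (leq_trans _ (ltnW sm)) //.
by apply/subset_leq_card/subsetP => x; rewrite !inE => /and3P[-> ->].
Qed.

Let o : 'I_w := Ordinal (ltnW (ltnW w_ge3)).

(** The default o is never met for i < m and k < 3, since the entries of a design are below w. *)
Let idx (i k : nat) : 'I_w := insubd o (nth 0 (nth [::] t i) k).

Let design_row i : i < m ->
  [/\ nth [::] t i = [:: idx i 0 : nat; idx i 1 : nat; idx i 2 : nat],
      idx i 0 != idx i 1, idx i 0 != idx i 2 & idx i 1 != idx i 2].
Proof.
move=> im; case/and3P: tP => /eqP tm /(all_nthP [::]) tr _.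
have := tr i; rewrite tm => /(_ im) /and3P[/eqP s3].
rewrite /idx; case: (nth [::] t i) s3 => [|a [|b [|c [|]]]] //= _.
rewrite !inE negb_or andbT => /andP[/andP[ab ac] bc] /and4P[aw bw cw _].
by split; rewrite -?val_eqE ?val_insubd /= ?aw ?bw ?cw.
Qed.

Let trip (f : 'I_w -> Y) i := (f (idx i 0), f (idx i 1), f (idx i 2)).

Let good_realizes (f : {ffun 'I_w -> Y}) (x0 : X) : injective f ->
  (forall i, i < m -> m <= #|common (trip f i)|) ->
  exists x, realizes N P w t x (fun j => f (insubd o j)).
Proof.
move=> finj fm; have [x [xinj xc]] := distinct_representatives x0 fm.
case/and3P: tP => /eqP tm _ _.
exists x; split=> [||i|i j]; rewrite ?tm //.
- move=> i j iw jw /finj/(congr1 val); rewrite !val_insubd.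
  by move: iw jw; rewrite !inE => -> ->.
- by move=> /xc; rewrite inE => /andP[].
move=> im; have := xc i im; rewrite inE => /andP[_] /and3P[h0 h1 h2].
have [-> _ _ _] := design_row im; rewrite !inE.
by case/or3P => /eqP ->; rewrite valKd.
Qed.

Hypothesis no_real : forall x y, ~ realizes N P w t x y.

(** Of the d^w maps from the w indices to [N x], an injective one without poor triples would give a
    realization. So each map has a collision, which happens at most w^2 d^(w-1) times, or a poor
    triple, at most m |poor x| d^(w-3) times. As 2 w^2 <= d, the collisions account for at most half
    of all maps. *)
Let degree_poor x : 2 * w ^ 2 <= #|N x| ->
  #|N x| ^ 3 <= 2 * m * #|poor x|.
Proof.
move=> dw; set d := #|N x|.
pose Om := [set f : {ffun 'I_w -> Y} | [forall i, f i \in N x]].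
pose fix1 (J : {set 'I_w}) (g : 'I_w -> Y) := [set f : {ffun 'I_w -> Y} |
   [forall i, f i \in N x] && [forall i in J, f i == g i]].
pose B1 := [set f in Om | [exists j, [exists k, (j != k) && (f j == f k)]]].
pose B2 := [set f in Om | [exists i : 'I_m, trip f i \in poor x]].
have OmE : #|Om| = d ^ w.
  rewrite -[w in d ^ w]card_ord -card_ffun_on; apply: eq_card => f.
  by rewrite !inE; apply/forallP/ffun_onP.
have OmB : Om \subset B1 :|: B2.
  apply/subsetP => f fO; move: (fO); rewrite inE => /forallP fN.
  rewrite in_setU ![f \in [set _ in _ | _]]inE fO /=; apply/orP.
  have [|/existsPn fd] := boolP [exists j, [exists k, (j != k) && (f j == f k)]].
    by left.
  right; apply/existsP.
  have finj : injective f.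
    move=> j k fjk; apply/eqP; apply: contraT => jk.
    by have /existsPn/(_ k) := fd j; rewrite jk fjk eqxx.
  have [/existsP[i fi]|/existsPn fg] := boolP [exists i : 'I_m, trip f i \in poor x].
    by exists i.
  have [] := @good_realizes f x finj.
    move=> i im; have := fg (Ordinal im); rewrite inE /= !fN /=.
    by rewrite -leqNgt.
  by move=> z /no_real.
have B1c : #|B1| <= w ^ 2 * d ^ (w - 1).
  apply: leq_trans (_ : #|[set: 'I_w * 'I_w]| * d ^ (w - 1) <= _); last first.
    by rewrite cardsT card_prod card_ord.
  pose B (p : 'I_w * 'I_w) := [set f in Om | (p.1 != p.2) && (f p.1 == f p.2)].
  apply: (@leq_card_cover _ _ _ _ B) => [f|[j k] _].
    rewrite inE => /andP[fO /existsP[j /existsP[k jk]]].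
    by exists (j, k); rewrite inE ?fO.
  have [->|jk] := eqVneq j k.
    by rewrite (_ : B _ = set0) ?cards0 //; apply/setP => f; rewrite !inE eqxx andbF.
  have -> : d ^ (w - 1) = #|N x| * d ^ (w - 2) by rewrite -expnS; congr (_ ^ _); lia.

  (* The common value y at j and k is one of d; the remaining w - 2 coordinates are free. *)
  apply: (@leq_card_cover _ _ _ _ (fun y => fix1 [set j; k] (fun=> y))).
    move=> f; rewrite !inE => /andP[/forallP fN /andP[_ /= /eqP fjk]].
    exists (f j); rewrite ?fN // inE; apply/andP; split; first exact/forallP.
    by apply/forall_inP => i; rewrite !inE => /orP[] /eqP -> //; rewrite fjk.
  move=> y _; rewrite (leq_trans (card_ffun_prescribed _ _ _)) //.
  by rewrite card_ord cards2 jk.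
have B2c : #|B2| <= m * #|poor x| * d ^ (w - 3).
  have -> : m * #|poor x| = #|setX [set: 'I_m] (poor x)|.
    by rewrite cardsX cardsT card_ord.
  (* For p = (i, s), a map whose i-th triple is s agrees with [g p] on the three indices in
     [J p]. *)
  pose g (p : 'I_m * (Y * Y * Y)) (j : 'I_w) :=
    if j == idx p.1 0 then p.2.1.1 else if j == idx p.1 1 then p.2.1.2 else p.2.2.
  pose J (p : 'I_m * (Y * Y * Y)) := [set idx p.1 0; idx p.1 1; idx p.1 2].
  apply: (@leq_card_cover _ _ _ _ (fun p => fix1 (J p) (g p))).
    move=> f; rewrite !inE => /andP[fN /existsP[i fi]].
    exists (i, trip f i); first by rewrite in_setX inE.
    rewrite inE fN /=; apply/forall_inP => j; rewrite !inE /g /=.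
    by do 2![case: eqP => [-> //|_]]; rewrite /= => /eqP ->.
  move=> p _; rewrite (leq_trans (card_ffun_prescribed _ _ _)) //.
  rewrite card_ord; have [_ n1 n2 n3] := design_row (ltn_ord p.1).
  have -> : #|J p| = 3; last by [].
  by rewrite /J setUC cardsU1 cards2 !inE n1 negb_or ![idx _ 2 == _]eq_sym n2 n3.
have := leq_trans (subset_leq_card OmB) (leq_card_setU _ _).
rewrite OmE => Ole; have {}Ole := leq_trans Ole (leq_add B1c B2c).
have d_gt0 : 0 < d by apply: leq_trans dw; rewrite muln_gt0 expn_gt0; lia.
have E1 : d ^ w = d ^ 3 * d ^ (w - 3) by rewrite -expnD; congr (_ ^ _); lia.
have E2 : d ^ (w - 1) = d ^ 2 * d ^ (w - 3).
  by rewrite -expnD; congr (_ ^ _); lia.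
move: Ole; rewrite E1 E2 mulnA -mulnDl leq_pmul2r ?expn_gt0 ?d_gt0 // => Ole.
have : w ^ 2 * d ^ 2 * 2 <= d ^ 3.
  by rewrite [d ^ 3]expnS mulnAC leq_mul2r [_ * 2]mulnC dw orbT.
by rewrite -mulnA; lia.
Qed.

Lemma sum_cube_degrees : (forall x, x \in P -> N x \subset Y0) ->
  \sum_(x in P | 2 * w ^ 2 <= #|N x|) #|N x| ^ 3 <= 2 * m ^ 2 * #|Y0| ^ 3.
Proof.
move=> NY; apply: (@leq_trans (\sum_(x in P) 2 * m * #|poor x|)).
  rewrite [leqRHS](bigID (fun x => 2 * w ^ 2 <= #|N x|)) /=.
  apply: leq_trans (leq_addr _ _); apply: leq_sum => x /andP[_].
  exact: degree_poor.
rewrite -big_distrr /= (leq_trans (leq_mul (leqnn _) (sum_poor NY))) //.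
by rewrite mulnA -[in leqRHS]mulnn !mulnA.
Qed.

End DependentRandomChoice.

(** * The upper bound *)

(** Order-free form of [no_power_product] for d = 3, with a duplicate-free list of naturals in place
    of an increasing tuple; [no_power_productP] proves the equivalence. *)
Definition no_cube_product (n k : nat) (A : {set 'I_n.+1}) : Prop :=
  forall (s : seq nat) (z : nat), uniq s -> size s = k ->
    (forall a, a \in s -> exists2 b, b \in A & val b = a) ->
    \prod_(a <- s) a <> z ^ 3.

Definition small_divisor (T a : nat) : nat :=
  \max_(d < (T ^ 3).+1 | d %| a) d.

Definition large_codivisor (T a : nat) : nat := a %/ small_divisor T a.

Lemma small_divisor_max T a d : d <= T ^ 3 -> d %| a -> d <= small_divisor T a.
Proof.
move=> dT da; rewrite -ltnS in dT.
exact: (@leq_bigmax_cond _ (fun d : 'I_(T ^ 3).+1 => d %| a)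
  (fun d => d : nat) (Ordinal dT)).
Qed.

Lemma small_divisorP T a : 0 < T ->
  [/\ small_divisor T a %| a, small_divisor T a <= T ^ 3
    & 0 < small_divisor T a].
Proof.
move=> T0; have T3 : 0 < T ^ 3 by rewrite expn_gt0 T0.
have [d da E] : {d : 'I_(T ^ 3).+1 | d %| a & small_divisor T a = d}.
  apply: eq_bigmax_cond; apply/card_gt0P; exists (Ordinal (T3 : 1 < (T ^ 3).+1)).
  exact: dvd1n.
have := small_divisor_max T3 (dvd1n a).
by rewrite E; split=> //; rewrite -ltnS.
Qed.

Lemma mul_large_codivisor T a : 0 < T ->
  large_codivisor T a * small_divisor T a = a.
Proof. by move=> T0; rewrite divnK //; case: (small_divisorP a T0). Qed.

(* If u = a / v is large and composite, its least prime factor p is at most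
   sqrt n, hence p <= v by maximality of v, and p * v contradicts maximality. *)
Lemma large_codivisor_prime T a : 0 < a < T ^ 6 ->
  T ^ 5 < large_codivisor T a -> prime (large_codivisor T a).
Proof.
move=> /andP[a0 aT].
have T0 : 0 < T by move: aT; case: (T) => //; rewrite ltnNge leq0n.
have [va vT v0] := small_divisorP a T0.
have := mul_large_codivisor a T0.
set u := large_codivisor T a; set v := small_divisor T a => uv uT.
have vltT : v < T.
  rewrite ltnNge; apply/negP => Tv.
  have := leq_mul (ltnW uT) Tv; rewrite uv -expnSr; lia.
apply: contraT => /primePns[u2|[p [pp p2 pu]]].
  by have : 0 < T ^ 5 by [rewrite expn_gt0 T0]; lia.
have pT : p <= T ^ 3.
  rewrite leqNgt; apply/negP => /ltnW h; have := leq_mul h h.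
  rewrite !mulnn -expnM => h2.
  have : u <= a by rewrite -uv leq_pmulr.
  lia.
have pv : p <= v.
  by apply: small_divisor_max => //; rewrite -uv dvdn_mulr.
have : p * v <= v.
  apply: small_divisor_max; last by rewrite -uv dvdn_mul.
  have := leq_mul pv (leqnn v); have := leq_mul vltT vltT.
  rewrite [T ^ 3]expnS -mulnn; nia.
by have := prime_gt1 pp; nia.
Qed.

(** [design] without its multiplicity condition: the counting for large u uses only the shape of t,
    and in [card_full_quadruple] the product is a cube for another reason. *)
Definition triples_below (m w : nat) (t : seq (seq nat)) : bool :=
  (size t == m) && all (fun s => [&& size s == 3, uniq s & all (gtn w) s]) t.

Lemma expn_prod (I : Type) (r : seq I) (P : pred I) (F : I -> nat) (k : nat) :
  (\prod_(i <- r | P i) F i) ^ k = \prod_(i <- r | P i) F i ^ k.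
Proof. by rewrite (big_morph (expn^~ k) (fun a b => expnMn a b k) (exp1n k)). Qed.

(** Exchanging the products, the exponent of y_j is the number of triples that contain j, a multiple
    of 3. *)
Lemma design_prod_cube (m w : nat) (t : seq (seq nat)) (y : nat -> nat) :
  design m w t -> exists z, \prod_(s <- t) \prod_(j <- s) y j = z ^ 3.
Proof.
case/and3P => _ /allP tr /allP tc.
exists (\prod_(j <- iota 0 w) y j ^ (count (fun s => j \in s) t %/ 3)).
transitivity (\prod_(j <- iota 0 w) \prod_(s <- t | j \in s) y j); last first.
  rewrite expn_prod; apply: eq_big_seq => j jw.
  by rewrite -expnM divnK ?tc // big_const_seq iter_muln_1.
rewrite [RHS](exchange_big_dep predT) //= big_seq [RHS]big_seq; apply: eq_bigr => s st.
case/and3P: (tr s st) => _ us /allP sw; rewrite -[RHS]big_filter.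
apply: perm_big; apply: uniq_perm => //; first by rewrite filter_uniq ?iota_uniq.
by move=> j; rewrite mem_filter mem_iota /= add0n; case: (boolP (j \in s)) => // /sw /= jw.
Qed.

(** * The bipartite graph of the factorizations a = u v *)

Section Configurations.

Variables (n T : nat) (A : {set 'I_n.+1}).
Hypotheses (T_gt0 : 0 < T) (nT : n < T ^ 6) (A0 : ord0 \notin A).

Definition neighbours (u : 'I_n.+1) : {set 'I_n.+1} :=
  [set v : 'I_n.+1 | [exists a in A,
     (large_codivisor T a == u) && (small_divisor T a == v)]].

Let mem_gt0 (a : 'I_n.+1) : a \in A -> 0 < a.
Proof.
move=> aA; rewrite lt0n; apply: contraNneq A0 => a0.
by rewrite (_ : ord0 = a) //; apply: val_inj.
Qed.

Lemma neighboursP (u v : 'I_n.+1) : v \in neighbours u ->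
  exists2 a : 'I_n.+1, a \in A &
    [/\ (a : nat) = u * v, large_codivisor T a = u & small_divisor T a = v].
Proof.
rewrite inE => /exists_inP[a aA /andP[/eqP ua /eqP va]]; exists a => //.
by split=> //; rewrite -ua -va mul_large_codivisor.
Qed.

Lemma neighbours_bounds (u v : 'I_n.+1) : v \in neighbours u ->
  [/\ 0 < u, 0 < v, u * v <= n, v <= T ^ 3 & T ^ 5 < u -> prime u].
Proof.
case/neighboursP => a aA [auv ua va].
have a0 := mem_gt0 aA.
have [_ vT _] := small_divisorP a T_gt0.
have an : a <= n by rewrite -ltnS.
split.
- by move: a0; rewrite auv muln_gt0 => /andP[].
- by move: a0; rewrite auv muln_gt0 => /andP[].
- by rewrite -auv.
- by rewrite -va.
by rewrite -ua => /large_codivisor_prime -> //; rewrite a0 (leq_ltn_trans an).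
Qed.

(** An element a is recovered from its pair (u, v), so A is in bijection with the edges. *)
Lemma card_sum_neighbours : #|A| = \sum_u #|neighbours u|.
Proof.
have [v0 _ _] : [/\ 0 < T ^ 3, true & true] by rewrite expn_gt0 T_gt0.
pose f (a : 'I_n.+1) : 'I_n.+1 := inord (large_codivisor T a).
pose g (a : 'I_n.+1) : 'I_n.+1 := inord (small_divisor T a).
have fE (a : 'I_n.+1) : f a = large_codivisor T a :> nat.
  by rewrite inordK // ltnS (leq_trans (leq_div _ _)) // -ltnS.
have gE (a : 'I_n.+1) : a \in A -> g a = small_divisor T a :> nat.
  move=> aA; rewrite inordK // ltnS; have [da _ _] := small_divisorP a T_gt0.
  by apply: leq_trans (dvdn_leq (mem_gt0 aA) da) _; rewrite -ltnS.
rewrite -[LHS]sum1_card (partition_big f predT) //=; apply: eq_bigr => u _.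
rewrite sum1dep_card.
have -> : neighbours u = [set g a | a in [set a in A | f a == u]].
  apply/setP => v; apply/idP/imsetP.
    case/neighboursP => a aA [_ ua va]; exists a.
      by rewrite inE aA; apply/eqP/val_inj; rewrite /= fE.
    by apply/val_inj; rewrite /= gE.
  case=> a; rewrite inE => /andP[aA /eqP <-] ->; rewrite inE; apply/exists_inP.
  by exists a => //; rewrite fE gE ?eqxx.
rewrite card_in_imset // => a b; rewrite !inE => /andP[aA /eqP fa] /andP[bA /eqP fb] gab.
apply/val_inj; rewrite /= -(mul_large_codivisor a T_gt0) -(mul_large_codivisor b T_gt0).
by rewrite -!fE -!gE // fa fb gab.
Qed.

Variables (m w : nat) (t : seq (seq nat)).

(** The 3m products x_i y_j are distinct because each determines its factors u and v, hence i and j.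
    Each x_i occurs three times and contributes a cube. *)
Lemma realizes_cube (P : {set 'I_n.+1}) (x y : nat -> 'I_n.+1) :
  no_cube_product (3 * m) A -> triples_below m w t ->
  realizes neighbours P w t x y ->
  (exists z, \prod_(s <- t) \prod_(j <- s) (y j : nat) = z ^ 3) -> False.
Proof.
move=> Acube /andP[/eqP tm /allP tr] [xinj yinj _ xy] [z tz].
pose L := [seq x i * y j | i <- iota 0 m, j <- nth [::] t i].
have tn i : i \in iota 0 m -> nth [::] t i \in t.
  by rewrite mem_iota => /andP[_ im]; rewrite mem_nth ?tm.
have tE : t = [seq nth [::] t i | i <- iota 0 m].
  by rewrite -tm -[LHS](mkseq_nth [::]).
apply: (Acube L ((\prod_(i <- iota 0 m) x i) * z)).
- apply: allpairs_uniq_dep; first exact: iota_uniq.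
    by move=> i /tn/tr/and3P[].
  move=> p q /allpairsPdep[i [j [im jt ->]]] /allpairsPdep[i' [j' [im' jt' ->]]] /=.
  have /and3P[_ _ /allP/(_ j jt) jw] := tr _ (tn _ im).
  have /and3P[_ _ /allP/(_ j' jt') jw'] := tr _ (tn _ im').
  move: im im'; rewrite !mem_iota !add0n /= -tm => im im'.
  have /neighboursP[a _ [auv ua va]] := xy i j im jt.
  have /neighboursP[b _ [buv ub vb]] := xy i' j' im' jt'.
  move=> e; have ab : a = b by apply/val_inj; rewrite /= auv buv.
  have -> : i = i' by apply: xinj => //; apply/val_inj; rewrite /= -ua -ub ab.
  by have -> : j = j' by apply: yinj => //; apply/val_inj; rewrite /= -va -vb ab.
- rewrite size_allpairs_dep sumnE big_map big_seq.
  rewrite (eq_bigr (fun=> 3)) => [|i /tn/tr/and3P[/eqP] //].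
  by rewrite -big_seq big_const_seq count_predT size_iota iter_addn_0.
- move=> a /allpairsPdep[i [j [im jt ->]]].
  move: im; rewrite mem_iota -tm => /= im.
  by have /neighboursP[b bA [E _ _]] := xy i j im jt; exists b.
rewrite big_allpairs_dep /= expnMn -tz [in \prod_(s <- t) _]tE big_map expn_prod.
rewrite -big_split /= !big_seq; apply: eq_bigr => i /tn/tr/and3P[/eqP s3 _ _].
rewrite big_split /=; congr (_ * _).
by rewrite big_const_seq count_predT s3 iter_muln_1.
Qed.

End Configurations.

Lemma leq_bin_exp (n k : nat) : 'C(n, k) <= n ^ k.
Proof.
elim: n k => [|n IHn] [|k]; rewrite ?bin0 ?bin0n //.
rewrite binS (leq_trans (leq_add (IHn k.+1) (IHn k))) //.
rewrite [n ^ k.+1]expnS -mulSnr expnS leq_mul2l.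
by case: k => // k; rewrite leq_exp2r // leqnSn.
Qed.

Lemma leq_excess_bin (d w : nat) : 0 < w -> d - w.-1 <= 'C(d, w).
Proof.
case: w => // w _ /=; elim: d => // d IHd.
rewrite binS; have [wd|dw] := leqP w d.
  by rewrite subSn // -addn1 leq_add // bin_gt0.
by rewrite (_ : d.+1 - w = 0) //; apply/eqP; rewrite subn_eq0.
Qed.

(** The excess of a degree over w - 1 is at most its number of w-subsets. A w-subset B of Y0 lies in
    at most m neighbourhoods: beyond that, m of these x and any enumeration of B realize t, whatever
    its triples are. *)
Lemma sum_degree_excess (X Y : finType) (N : X -> {set Y}) (P : {set X})
    (Y0 : {set Y}) (m w : nat) (t : seq (seq nat)) :
  0 < w -> triples_below m w t ->
  (forall x y, ~ realizes N P w t x y) ->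
  (forall x, x \in P -> N x \subset Y0) ->
  \sum_(x in P) (#|N x| - w.-1) <= m * #|Y0| ^ w.
Proof.
move=> w0 /andP[/eqP tm /allP tr] no_real NY.
apply: (@leq_trans (\sum_(x in P) \sum_(B : {set Y} | (B \subset Y0) && (#|B| == w))
    (B \subset N x))).
  apply: leq_sum => x xP; rewrite (leq_trans (leq_excess_bin _ w0)) //.
  rewrite -cards_draws -sum1dep_card big_mkcond [leqRHS]big_mkcond /=.
  apply: leq_sum => B _; have [BN|//] := boolP (B \subset N x).
  by rewrite (subset_trans BN) ?NY //=; case: ifP.
rewrite exchange_big /=; apply: (@leq_trans
    (\sum_(B : {set Y} | (B \subset Y0) && (#|B| == w)) m)); last first.
  by rewrite sum_nat_cond_const cards_draws mulnC leq_mul2l leq_bin_exp orbT.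
apply: leq_sum => B /andP[_ /eqP Bw].
rewrite leqNgt; apply/negP; rewrite -big_mkcondr sum1dep_card.
set F := [set x | _] => Fm.
have /card_gt0P[x0 _] : 0 < #|F| by apply: leq_ltn_trans Fm.
have /card_gt0P[y0 _] : 0 < #|B| by rewrite Bw.
have [x [xinj xF]] := distinct_representatives (F := fun=> F) x0
  (fun i (_ : i < m) => ltnW Fm).
apply: (no_real x (fun j => nth y0 (enum B) j)); split; rewrite ?tm //.
- move=> i j; rewrite !inE => iw jw /eqP.
  by rewrite nth_uniq ?enum_uniq -?cardE ?Bw // => /eqP.
- by move=> i /xF; rewrite inE => /andP[].
move=> i j im jt; have := xF i im; rewrite inE => /andP[_ /subsetP]; apply.
rewrite -mem_enum mem_nth // -cardE Bw.
have it : nth [::] t i \in t by rewrite mem_nth ?tm.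
by have /and3P[_ _ /allP/(_ j jt)] := tr _ it.
Qed.

Lemma card_ord_interval (n c : nat) : #|[set v : 'I_n | 0 < v <= c]| <= c.
Proof.
pose f (v : 'I_n) := (v : nat).-1.
have: uniq [seq f v | v <- enum [set v : 'I_n | 0 < v <= c]].
  rewrite map_inj_in_uniq ?enum_uniq // => u v.
  by rewrite !mem_enum !inE /f => u0 v0 uv; apply/val_inj => /=; lia.
move=> /(@uniq_leq_size _ _ (iota 0 c)); rewrite size_map size_iota -cardE; apply.
move=> i /mapP[v]; rewrite mem_enum inE mem_iota /f => v0 ->; lia.
Qed.

Lemma sum_divn_exp2 (K J : nat) : \sum_(j < J) K %/ 2 ^ j <= 2 * K.
Proof.
elim: J K => [|J IHJ] K; first by rewrite big_ord0.
rewrite big_ord_recl expn0 divn1.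
under eq_bigr => j _ do rewrite lift0 expnS divnMA.
rewrite (leq_trans (leq_add (leqnn K) (IHJ _))) //.
by rewrite [2 * K]mul2n -addnn leq_add2l mulnC leq_trunc_div.
Qed.

(** * Edges with u at most T^5 *)

Section SmallPart.

Variables (n T : nat) (A : {set 'I_n.+1}).
Hypotheses (T_gt0 : 0 < T) (nT : n < T ^ 6) (A0 : ord0 \notin A).
Variables (m w : nat) (t : seq (seq nat)).
Hypotheses (w_ge3 : 2 < w) (tP : design m w t).

Let N := @neighbours n T A.

Hypothesis no_real : forall P x y, ~ realizes N P w t x y.

Let scale (u : nat) := up_log 8 (u %/ T ^ 3).+1.

Let T3_gt0 : 0 < T ^ 3. Proof. by rewrite expn_gt0 T_gt0. Qed.

Let scale_ub u : u <= 8 ^ scale u * T ^ 3.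
Proof.
have := up_logP (u %/ T ^ 3).+1 (isT : 1 < 8); rewrite -/(scale u) => h.
by rewrite (leq_trans (ltnW (ltn_ceil u T3_gt0))) // leq_mul2r h orbT.
Qed.

Let scale_nb (u v : 'I_n.+1) : v \in N u -> v * 8 ^ scale u <= 8 * T ^ 3.
Proof.
move=> /(neighbours_bounds T_gt0 nT A0)[u0 v0 uvn vT _].
have [->|s0] := posnP (scale u).
  by rewrite expn0 muln1 (leq_trans vT) // leq_pmull.
have u1 : 1 < (u %/ T ^ 3).+1.
  by rewrite ltnNge; apply/negP => h; move: s0; rewrite /scale lt0n up_log_eq0 h orbT.
have := up_log_gtn (isT : 1 < 8) u1; rewrite -/(scale u) ltnS leq_divRL // => h.
have -> : 8 ^ scale u = 8 * 8 ^ (scale u).-1 by rewrite -expnS prednK.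
rewrite mulnCA leq_mul2l /= ltnW // -(ltn_pmul2r T3_gt0) -[T ^ 3 * _]expnD.
rewrite (leq_ltn_trans _ nT) // (leq_trans _ uvn) // -mulnA mulnC.
by rewrite leq_mul2r h orbT.
Qed.

Let piece (j : nat) : {set 'I_n.+1} :=
  [set u : 'I_n.+1 | (0 < u <= T ^ 5) && (scale u == j)].

(* Weighting a degree d by d a^2 b <= a^3 + (b d)^3, where a / b is the degree
   to be expected, balances the two terms of the count. *)
Let piece_bound j :
  \sum_(u in piece j | 2 * w ^ 2 <= #|N u|) #|N u|
    <= (8 * (1 + 2 * m ^ 2) * T ^ 5) %/ 2 ^ j.
Proof.
pose Y0 := [set v : 'I_n.+1 | 0 < v <= (8 * T ^ 3) %/ 8 ^ j].
have e8 : 0 < 8 ^ j by rewrite expn_gt0.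
have e2 : 0 < 2 ^ j by rewrite expn_gt0.
have NY u : u \in piece j -> N u \subset Y0.
  rewrite inE => /andP[_ /eqP uj]; apply/subsetP => v vu.
  have [_ v0 _ _ _] := neighbours_bounds T_gt0 nT A0 vu.
  by rewrite inE v0 leq_divRL // -uj scale_nb.
have Y0c : #|Y0| * 8 ^ j <= 8 * T ^ 3 by rewrite -leq_divRL // card_ord_interval.
have Pc : #|piece j| <= 8 ^ j * T ^ 3.
  apply: leq_trans (card_ord_interval n.+1 (8 ^ j * T ^ 3)).
  apply/subset_leq_card/subsetP => u; rewrite !inE => /andP[/andP[-> _] /eqP <-].
  exact: scale_ub.
have S3 := sum_cube_degrees w_ge3 tP (no_real (P := piece j)) NY.
set S := \sum_(u in _ | _) _.
(* The expected degree is a / b = 8 T^2 / 16^j. With |piece j| <= 8^j T^3 and |Y0| <= 8 T^3 / 8^j,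
   both terms of [SE] divided by a^2 b are O(T^5 / 2^j). *)
pose a := 8 * T ^ 2; pose b := 8 ^ j * 2 ^ j.
have SE : S * (a ^ 2 * b) <= #|piece j| * a ^ 3 + b ^ 3 * (2 * m ^ 2 * #|Y0| ^ 3).
  apply: (@leq_trans (\sum_(u in piece j | 2 * w ^ 2 <= #|N u|)
      (a ^ 3 + b ^ 3 * #|N u| ^ 3))).
    rewrite big_distrl /=; apply: leq_sum => u _; set d := #|N u|.
    rewrite -expnMn mulnC -mulnA; have [h|h] := leqP (b * d) a.
      by apply: leq_trans (leq_addr _ _); rewrite [leqRHS]expnSr leq_mul2l h orbT.
    apply: leq_trans (leq_addl _ _).
    by rewrite [leqRHS]expnSr leq_mul2r leq_sqr ltnW ?orbT.
  rewrite big_split leq_add //; last first.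
    by rewrite -big_distrr leq_mul2l S3 orbT.
  rewrite sum_nat_cond_const leq_mul2r subset_leq_card ?orbT //.
  by apply/subsetP => u; rewrite !inE => /andP[].
have bY : b ^ 3 * #|Y0| ^ 3 <= 8 ^ j * (T ^ 3) ^ 3 * 512.
  rewrite -expnMn /b (leq_trans (_ : _ <= (2 ^ j * (8 * T ^ 3)) ^ 3)) //.
    rewrite leq_exp2r // [8 ^ j * _]mulnC -mulnA [8 ^ j * _]mulnC.
    by rewrite leq_mul2l Y0c orbT.
  by rewrite expnMn -expnM [j * 3]mulnC expnM expnMn mulnA mulnAC.
have aP : #|piece j| * a ^ 3 <= 8 ^ j * (T ^ 3) ^ 3 * 512.
  rewrite (leq_trans (leq_mul Pc (leqnn _))) // /a expnMn -!(expnM T).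
  rewrite -[3 * 3]/(3 + 2 * 3) expnD -[8 ^ 3]/512.
  by move: (8 ^ j) (T ^ 3) (T ^ (2 * 3)) => c1 c2 c3; lia.
rewrite leq_divRL //.
have T4 : 0 < T ^ 4 by rewrite expn_gt0 T_gt0.
have c_gt0 : 0 < 64 * T ^ 4 * 8 ^ j by rewrite muln_gt0 e8 muln_gt0 T4.
rewrite -(leq_pmul2r c_gt0).
have -> : S * 2 ^ j * (64 * T ^ 4 * 8 ^ j) = S * (a ^ 2 * b).
  rewrite /a /b expnMn -expnM -[8 ^ 2]/64 -[2 * 2]/4.
  by move: {SE}S (2 ^ j) (8 ^ j) (T ^ 4) => c1 c2 c3 c4; lia.
apply: (leq_trans SE).
have -> : 8 * (1 + 2 * m ^ 2) * T ^ 5 * (64 * T ^ 4 * 8 ^ j)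
  = 8 ^ j * (T ^ 3) ^ 3 * 512 + 2 * m ^ 2 * (8 ^ j * (T ^ 3) ^ 3 * 512).
  rewrite -(expnM T) -[3 * 3]/(5 + 4) expnD.
  by move: (T ^ 5) (T ^ 4) (8 ^ j) (m ^ 2) => c1 c2 c3 c4; lia.
by rewrite leq_add // mulnCA leq_mul2l bY orbT.
Qed.

(** Vertices of degree below 2 w^2 contribute at most 2 w^2 T^5. For the others the bounds of
    [piece_bound] form a geometric series of ratio 1/2, which doubles its constant 8 (1 + 2 m^2). *)
Lemma sum_small_degrees :
  \sum_(u : 'I_n.+1 | u <= T ^ 5) #|N u|
    <= (2 * w ^ 2 + 16 * (1 + 2 * m ^ 2)) * T ^ 5.
Proof.
rewrite (bigID (fun u : 'I_n.+1 => 0 < u)) /=.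
rewrite [X in _ + X]big1 ?addn0 => [|u /andP[_ u0]]; last first.
  apply: eq_card0 => v; apply/negP => /(neighbours_bounds T_gt0 nT A0)[].
  by rewrite (negPf u0).
pose Q := [set u : 'I_n.+1 | 0 < u <= T ^ 5].
rewrite (eq_bigl (mem Q)) => [|u]; last by rewrite [RHS]inE andbC.
rewrite (bigID (fun u => 2 * w ^ 2 <= #|N u|)) /= addnC mulnDl leq_add //.
  apply: (@leq_trans (\sum_(u in Q) 2 * w ^ 2)).
    rewrite [leqRHS](bigID (fun u => 2 * w ^ 2 <= #|N u|)) /=.
    apply: leq_trans (leq_addl _ _); apply: leq_sum => u /andP[_].
    by rewrite -ltnNge => /ltnW.
  by rewrite sum_nat_const mulnC leq_mul2l card_ord_interval orbT.
have sJ (u : 'I_n.+1) : scale u < n.+2.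
  have h : scale u <= (u %/ T ^ 3).+1 by apply: up_log_min => //; apply/ltnW/ltn_expl.
  by rewrite ltnS (leq_trans h) // ltnS (leq_trans (leq_div _ _)) // -ltnS.
rewrite (partition_big (fun u => Ordinal (sJ u)) predT) //=.
rewrite (_ : 16 = 2 * 8) // -!mulnA [8 * _]mulnA.
apply: leq_trans (sum_divn_exp2 _ n.+2); apply: leq_sum => j _.
apply: leq_trans (piece_bound j); rewrite leq_eqVlt; apply/orP; left; apply/eqP.
apply: eq_bigl => u; rewrite !inE -val_eqE /=.
by rewrite -!andbA; do !bool_congr; rewrite andbC.
Qed.

End SmallPart.

Definition nat_pi (x : nat) : nat := count prime (iota 0 x.+1).

Lemma nat_pi_sum (n k : nat) : k <= n ->
  nat_pi k = \sum_(u < n.+1 | prime u) (u <= k).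
Proof.
move=> kn; rewrite /nat_pi -sum1_count -[iota 0 k.+1]/(index_iota 0 k.+1) big_mkord.
rewrite (big_ord_widen_cond n.+1 prime (fun=> 1)) // big_mkcondr /=.
by apply: eq_bigr => u _; rewrite ltnS; case: ifP.
Qed.

(** * Edges with u a prime larger than T^5 *)

Section LargePart.

Variables (n T : nat) (A : {set 'I_n.+1}).
Hypotheses (T_gt0 : 0 < T) (nT : n < T ^ 6) (A0 : ord0 \notin A).
Variables (m w : nat) (t : seq (seq nat)).
Hypotheses (w_ge3 : 2 < w) (w_le5 : w <= 5) (tP : design m w t).
Hypothesis (Acube : no_cube_product (3 * m) A).

Let N := @neighbours n T A.

Let no_real (P : {set 'I_n.+1}) x y : ~ realizes N P w t x y.
Proof.
move=> r; apply: (realizes_cube T_gt0 Acube _ r); last exact: design_prod_cube tP.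
by case/and3P: tP => h1 h2 _; apply/andP.
Qed.

Let L := [set u : 'I_n.+1 | (T ^ 5 < u) && prime u].

Let const := 2 * w ^ 2 + 16 * (1 + 2 * m ^ 2).

Lemma card_le_large : #|A| <= const * T ^ 5 + \sum_(u in L) #|N u|.
Proof.
rewrite (card_sum_neighbours T_gt0 A0) (bigID (fun u : 'I_n.+1 => u <= T ^ 5)) /=.
rewrite leq_add ?(sum_small_degrees T_gt0 nT A0 w_ge3 tP no_real) //.
rewrite [leqRHS]big_mkcond [leqLHS]big_mkcond; apply: leq_sum => u _.
rewrite -ltnNge inE; case: ltnP => //= Tu; case: ifP => // /negP up.
have [->|[v vu]] := set_0Vmem (neighbours T A u); first by rewrite cards0.
by have [_ _ _ _ /(_ Tu)] := neighbours_bounds T_gt0 nT A0 vu.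
Qed.

Lemma neighbours_large (u : 'I_n.+1) : u \in L ->
  N u \subset [set v : 'I_n.+1 | 0 < v <= n %/ u] /\
  N u \subset [set v : 'I_n.+1 | 0 < v <= T].
Proof.
rewrite inE => /andP[Tu /prime_gt0 u0].
split; apply/subsetP => v /(neighbours_bounds T_gt0 nT A0)[_ v0 uvn _ _].
  by rewrite inE v0 leq_divRL // mulnC.
rewrite inE v0 leqNgt; apply/negP => Tv.
have := leq_mul (ltnW Tu) (ltnW Tv); rewrite -expnSr leqNgt.
by rewrite (leq_ltn_trans uvn).
Qed.

Lemma degree_large (u : 'I_n.+1) : u \in L -> #|N u| <= n %/ u.
Proof.
move=> uL; have [h _] := neighbours_large uL.
by rewrite (leq_trans (subset_leq_card h)) ?card_ord_interval.
Qed.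

(** All labels adjacent to a large u are at most T, and T^w <= T^5 because w <= 5. *)
Lemma sum_excess_large : \sum_(u in L) (#|N u| - w.-1) <= m * T ^ 5.
Proof.
have tr : triples_below m w t by case/and3P: tP => h1 h2 _; apply/andP.
pose Y0 := [set v : 'I_n.+1 | 0 < v <= T].
have LY u : u \in L -> N u \subset Y0 by move=> /neighbours_large[].
have w0 : 0 < w by apply: leq_trans w_ge3.
apply: leq_trans (sum_degree_excess w0 tr (no_real (P := L)) LY) _.
rewrite leq_mul2l (leq_trans (_ : _ <= T ^ w)) ?orbT //.
  by rewrite leq_exp2r // card_ord_interval.
by rewrite leq_pexp2l.
Qed.

Lemma sum_multiples (c : nat) : 0 < c ->
  \sum_(u in L) (c <= n %/ u) <= nat_pi (n %/ c).
Proof.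
move=> c0; rewrite (nat_pi_sum (leq_div n c)) [leqRHS]big_mkcond [leqLHS]big_mkcond.
apply: leq_sum => u _; rewrite inE; case: (T ^ 5 < u) => //=.
by case: ifP => // /prime_gt0 u0; rewrite !leq_divRL // mulnC.
Qed.

(** A degree is at most n %/ u, hence at most the number of c < w with c <= n %/ u, plus its excess
    over w - 1. Summing over primes u turns c <= n %/ u, that is u <= n %/ c, into a prime count. *)
Lemma card_le_consecutive : #|A| <=
  \sum_(c <- iota 1 w.-1) nat_pi (n %/ c) + (const + m) * T ^ 5.
Proof.
rewrite mulnDl addnCA (leq_trans card_le_large) // leq_add2l.
apply: (@leq_trans (\sum_(u in L)
    (\sum_(c <- iota 1 w.-1) (c <= n %/ u) + (#|N u| - w.-1)))).
  have aux v d k : 2 < v -> v <= 5 -> d <= k ->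
      d <= \sum_(c <- iota 1 v.-1) (c <= k) + (d - v.-1).
    by case: v => [|[|[|[|[|[|]]]]]] //= _ _; rewrite !big_cons big_nil; lia.
  by apply: leq_sum => u uL; apply: aux => //; apply: degree_large.
rewrite big_split leq_add ?sum_excess_large //= exchange_big /=.
rewrite !big_seq; apply: leq_sum => c; rewrite mem_iota => /andP[c0 _].
exact: sum_multiples.
Qed.

(* The multipliers 1, 2, 4 have product 2^3, so 4 must be avoided. *)
Lemma card_full_quadruple : 0 < m ->
  #|[set u in L | (n %/ u == 4) && (3 < #|N u|)]| <= m.
Proof.
move=> m0; set F := [set u in L | _]; rewrite leqNgt; apply/negP => Fm.
have FN u : u \in F -> 4 <= n /\ forall v : 'I_n.+1, 0 < v <= 4 -> v \in N u.
  rewrite inE => /and3P[uL /eqP nu Nu]; have [NE _] := neighbours_large uL.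
  rewrite nu in NE; split; first by rewrite -nu leq_div.
  suff -> : N u = [set v : 'I_n.+1 | 0 < v <= 4] by move=> v vb; rewrite inE.
  apply/eqP; rewrite eqEcard NE /= (leq_trans _ Nu) //.
  exact: card_ord_interval.
have /card_gt0P[x0 x0F] : 0 < #|F| by apply: leq_ltn_trans Fm.
have n4 : 4 <= n by case: (FN x0 x0F).
have [x [xinj xF]] := distinct_representatives (F := fun=> F) x0
  (fun i (_ : i < m) => ltnW Fm).
pose y j : 'I_n.+1 := inord (2 ^ j).
have yE j : j < 3 -> y j = 2 ^ j :> nat.
  by move=> j3; rewrite inordK // ltnS (leq_trans _ n4) // (leq_pexp2l _ (j3 : j <= 2)).
have y4 j : j < 3 -> 0 < y j <= 4.
  by move=> j3; rewrite yE // expn_gt0 /= (leq_pexp2l _ (j3 : j <= 2)).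
pose s := nseq m (iota 0 3).
have r : realizes N F 3 s x y.
  split; rewrite ?size_nseq //.
    move=> i j; rewrite !inE => i3 j3 /(congr1 val) /=.
    by rewrite !yE // => /eqP; rewrite eqn_exp2l // => /eqP.
  move=> i j im; rewrite nth_nseq im mem_iota => /= j3.
  by have [_] := FN _ (xF i im); apply; apply: y4.
apply: (realizes_cube T_gt0 Acube _ r).
  by rewrite /triples_below size_nseq eqxx all_nseq orbT.
exists (2 ^ m); rewrite big_seq (eq_bigr (fun=> 2 ^ 3)); last first.
  move=> q; rewrite mem_nseq => /andP[_ /eqP ->].
  by rewrite !big_cons big_nil !yE.
by rewrite -big_seq big_const_seq count_predT size_nseq iter_muln_1 -!expnM mulnC.
Qed.

(** Replacing the multiplier 4 by 5 loses something only when n %/ u = 4 and u has all four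
    neighbours. [card_full_quadruple] allows at most m such u, whence the second m in the
    constant. *)
Lemma card_le_1235 : w = 5 -> 0 < m -> #|A| <=
  \sum_(c <- [:: 1; 2; 3; 5]) nat_pi (n %/ c) + (const + 2 * m) * T ^ 5.
Proof.
move=> w5 m0; rewrite mulnDl addnCA (leq_trans card_le_large) // leq_add2l.
apply: (@leq_trans (\sum_(u in L)
    (\sum_(c <- [:: 1; 2; 3; 5]) (c <= n %/ u) + ((#|N u| - w.-1) +
      ((n %/ u == 4) && (3 < #|N u|)))))).
  apply: leq_sum => u uL; have := degree_large uL; rewrite w5.
  move: #|N u| (n %/ u) => d k; rewrite !big_cons big_nil /=; lia.
rewrite big_split leq_add //=.
  rewrite exchange_big /= !big_seq; apply: leq_sum => c.
  by rewrite !inE => /or4P[] /eqP ->; exact: sum_multiples.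
rewrite big_split /= mul2n -addnn mulnDl leq_add ?sum_excess_large //.
have T5 : 0 < T ^ 5 by rewrite expn_gt0 T_gt0.
rewrite -big_mkcondr sum1dep_card (leq_trans _ (leq_pmulr _ T5)) //.
apply: leq_trans (card_full_quadruple m0).
by apply/subset_leq_card/subsetP => u; rewrite !inE.
Qed.

End LargePart.

(** * Central binomial coefficients and primes *)

Lemma logn_fact_widen (p n N : nat) : prime p -> n <= N ->
  logn p n`! = \sum_(1 <= i < N.+1) n %/ p ^ i.
Proof.
move=> pp nN; rewrite logn_fact // (@big_cat_nat _ _ _ n.+1 1 N.+1) //=.
rewrite [X in _ + X]big_nat_cond [X in _ + X]big1 ?addn0 // => i /andP[/andP[ni _] _].
rewrite divn_small // (leq_trans (ltn_expl n (prime_gt1 pp))) // leq_pexp2l ?prime_gt0 //.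
exact: ltnW.
Qed.

(** In Legendre's formula p^i contributes the difference of the floor of 2k / p^i and twice the
    floor of k / p^i: at most 1, and 0 once p^i > 2k. *)
Lemma central_bin_pfactor (p k : nat) : prime p -> 0 < k ->
  p ^ logn p 'C(k.*2, k) <= k.*2.
Proof.
move=> pp k0; have p1 := prime_gt1 pp.
have k2 : 0 < k.*2 by rewrite double_gt0.
apply: leq_trans (trunc_logP p1 k2); rewrite leq_pexp2l ?prime_gt0 //.
have kk : k <= k.*2 by rewrite -addnn leq_addr.
have := congr1 (logn p) (bin_fact kk).
rewrite (_ : k.*2 - k = k); last by rewrite -addnn addnK.
rewrite !lognM ?muln_gt0 ?fact_gt0 ?bin_gt0 ?kk // (logn_fact_widen pp kk).
rewrite (logn_fact_widen pp (leqnn _)) addnn -[(bigop _ _ _).*2]muln2 big_distrl /=.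
set c := logn p _; set t := trunc_log _ _.
suff h : \sum_(1 <= i < k.*2.+1) k.*2 %/ p ^ i <=
    \sum_(1 <= i < k.*2.+1) k %/ p ^ i * 2 + t.
  by move=> E; rewrite -E addnC leq_add2l in h.
have -> : t = \sum_(1 <= i < k.*2.+1) (i <= t).
  rewrite (@big_cat_nat _ _ _ t.+1 1 k.*2.+1) //=; last first.
    by rewrite ltnS (leq_trans _ (trunc_logP p1 k2)) // ltnW // ltn_expl.
  rewrite [X in _ = _ + X]big_nat_cond [X in _ = _ + X]big1 ?addn0; last first.
    by move=> i /andP[/andP[ti _] _]; rewrite leqNgt ti.
  rewrite big_nat (eq_bigr (fun=> 1)); last by move=> i /andP[_]; rewrite ltnS => ->.
  by rewrite -big_nat sum_nat_const_nat subn1 muln1.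
rewrite -big_split; apply: leq_sum => i _ /=.
have q0 : 0 < p ^ i by rewrite expn_gt0 prime_gt0.
have [it|ti] := leqP i t.
  rewrite /= -ltnS ltn_divLR // -mul2n; have := ltn_ceil k q0.
  by move: (p ^ i) (k %/ p ^ i) => q d; nia.
rewrite divn_small // (leq_trans (trunc_log_ltn _ p1)) // leq_pexp2l ?prime_gt0 //.
Qed.

Lemma central_bin_ge (k : nat) : 2 ^ k <= 'C(k.*2, k).
Proof.
elim: k => // k IHk; rewrite doubleS binS.
have -> : 'C(k.*2.+1, k) = 'C(k.*2.+1, k.+1).
  have kk : k.+1 <= k.*2.+1 by rewrite ltnS -addnn leq_addr.
  by rewrite -(bin_sub kk) subSS (_ : k.*2 - k = k) // -addnn addnK.
by rewrite addnn -mul2n expnS leq_mul2l /= binS (leq_trans IHk) // leq_addl.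
Qed.

(** Only primes up to 2k divide the coefficient, and each prime power in it is at most 2k. *)
Lemma central_bin_le (k : nat) : 0 < k -> 'C(k.*2, k) <= k.*2 ^ nat_pi k.*2.
Proof.
move=> k0; set b := 'C(_, _).
have b0 : 0 < b by rewrite bin_gt0 -addnn leq_addr.
rewrite {1}[b]prod_prime_decomp // prime_decompE big_map /=.
apply: (@leq_trans (\prod_(p <- primes b) k.*2)).
  rewrite big_seq [leqRHS]big_seq; apply: leq_prod => p.
  by rewrite mem_primes => /and3P[pp _ _]; apply: central_bin_pfactor.
rewrite big_const_seq count_predT iter_muln_1 leq_pexp2l ?double_gt0 //.
rewrite /nat_pi -size_filter uniq_leq_size ?primes_uniq // => p.
rewrite mem_filter mem_iota /= add0n ltnS => pb; have := pb.
rewrite mem_primes => /and3P[pp _ _]; rewrite pp /=.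
apply: leq_trans (central_bin_pfactor pp k0); rewrite -[leqLHS]expn1.
by apply: leq_pexp2l; [apply: prime_gt0 | rewrite logn_gt0].
Qed.

Lemma chebyshev_lower (k : nat) : 0 < k -> 2 ^ k <= k.*2 ^ nat_pi k.*2.
Proof. by move=> k0; apply: leq_trans (central_bin_ge k) (central_bin_le k0). Qed.

(** * Graphs without short cycles *)

Lemma card_dep_pairs (I J : finType) (P : pred I) (Q : I -> pred J) :
  #|[set x : I * J | P x.1 && Q x.1 x.2]| = \sum_(i | P i) #|[set j | Q i j]|.
Proof.
rewrite -sum1dep_card -(pair_big_dep P Q (fun _ _ => 1)) /=.
by apply: eq_bigr => i _; rewrite sum1dep_card.
Qed.

Section IncidenceGraphs.

Variables (P L : finType) (e : P -> L -> bool).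

Definition triple_degrees (E : {set P * L}) : Prop :=
  (forall p, 3 %| #|[set l | (p, l) \in E]|) /\
  (forall l, 3 %| #|[set p | (p, l) \in E]|).

Definition quadrangle_free : Prop := forall p p' l l',
  e p l -> e p l' -> e p' l -> e p' l' -> p = p' \/ l = l'.

Definition hexagon_free : Prop := forall p0 p1 p2 l1 l l2,
  p0 != p1 -> p0 != p2 -> p1 != p2 -> l1 != l2 -> l != l1 -> l != l2 ->
  e p0 l1 -> e p1 l1 -> e p1 l -> e p2 l -> e p2 l2 -> e p0 l2 -> False.

Hypothesis e4 : quadrangle_free.
Variable E : {set P * L}.
Hypotheses (Ee : forall p l, (p, l) \in E -> e p l) (E3 : triple_degrees E).

Lemma degree_ge3_point p l : (p, l) \in E -> 3 <= #|[set l | (p, l) \in E]|.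
Proof.
move=> plE; apply: dvdn_leq (E3.1 p).
by apply/card_gt0P; exists l; rewrite inE.
Qed.

Lemma degree_ge3_line p l : (p, l) \in E -> 3 <= #|[set p | (p, l) \in E]|.
Proof.
move=> plE; apply: dvdn_leq (E3.2 l).
by apply/card_gt0P; exists p; rewrite inE.
Qed.

Lemma card_ge_points (D : {set P}) :
  (forall p, p \in D -> exists l, (p, l) \in E) -> 3 * #|D| <= #|E|.
Proof.
move=> DE; rewrite mulnC -sum_nat_const.
have -> : #|E| = \sum_p #|[set l | (p, l) \in E]|.
  rewrite -(card_dep_pairs predT (fun p l => (p, l) \in E)).
  by apply: eq_card => -[p l]; rewrite !inE.
rewrite [leqRHS](bigID (mem D)) /= (leq_trans _ (leq_addr _ _)) //.
by apply: leq_sum => p /DE[l]; apply: degree_ge3_point.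
Qed.

Lemma card_ge_lines (D : {set L}) :
  (forall l, l \in D -> exists p, (p, l) \in E) -> 3 * #|D| <= #|E|.
Proof.
move=> DE; rewrite mulnC -sum_nat_const.
have -> : #|E| = \sum_l #|[set p | (p, l) \in E]|.
  rewrite -(card_dep_pairs predT (fun l p => (p, l) \in E))
    -(card_imset E (f := fun x : P * L => (x.2, x.1))); last first.
    by move=> [p l] [p' l'] [-> ->].
  apply: eq_card => -[l p]; rewrite !inE /=; apply/imsetP/idP => [[[p' l'] h [-> ->]]|h] //.
  by exists (p, l).
rewrite [leqRHS](bigID (mem D)) /= (leq_trans _ (leq_addr _ _)) //.
by apply: leq_sum => l /DE[p]; apply: degree_ge3_line.
Qed.

Section FromPoint.

Variable p0 : P.

(** Paths p0 - l - p of length 2. Without quadrangles their end points are distinct ([S_inj]). *)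
Let S := [set x : L * P | ((p0, x.1) \in E) && ((x.2, x.1) \in E) && (x.2 != p0)].

Let S_inj : {in S &, injective snd}.
Proof.
move=> [l p] [l' p']; rewrite !inE /= => /andP[/andP[h1 h2] h3].
move=> /andP[/andP[h4 h5] h6] pp; rewrite -pp in h5 *; congr (_, _).
by case: (e4 (Ee h1) (Ee h4) (Ee h2) (Ee h5)) => // E0; rewrite E0 eqxx in h3.
Qed.

Let S_card l0 : (p0, l0) \in E -> 6 <= #|S|.
Proof.
move=> pl0; have := degree_ge3_point pl0; set Ls := [set l | _] => Ls3.
have -> : #|S| = \sum_(l in Ls) #|[set p | ((p, l) \in E) && (p != p0)]|.
  rewrite -(card_dep_pairs (mem Ls) (fun l p => ((p, l) \in E) && (p != p0))).
  by apply: eq_card => x; rewrite !inE andbA.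
apply: (@leq_trans (\sum_(l in Ls) 2)).
  by rewrite sum_nat_const (leq_mul2r 2 3).
apply: leq_sum => l; rewrite inE => pl.
have := degree_ge3_line pl; rewrite (cardsD1 p0) inE pl add1n ltnS.
by move=> /leq_trans -> //; apply/subset_leq_card/subsetP => p; rewrite !inE andbC.
Qed.

(** At least 3 lines through p0 with at least 2 further points each give 6 distinct points, each on
    at least 3 edges. *)
Lemma quadrangle_free_card l0 : (p0, l0) \in E -> 18 <= #|E|.
Proof.
move=> /S_card S6; rewrite -(card_in_imset S_inj) in S6.
apply: leq_trans (card_ge_points (D := snd @: S) _).
  by rewrite (leq_mul2l 3 6).
by move=> _ /imsetP[[l p] + ->]; rewrite inE => /andP[/andP[_ h] _]; exists l.
Qed.

(** Paths p0 - l - p - l' of length 3 that do not turn back. *)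
Let S2 := [set x : (L * P) * L | (x.1 \in S) && (((x.1.2, x.2) \in E) && (x.2 != x.1.1))].

Let S2_card l0 : (p0, l0) \in E -> 12 <= #|S2|.
Proof.
move=> /S_card S6; rewrite (card_dep_pairs (mem S)
  (fun (x : L * P) (l' : L) => ((x.2, l') \in E) && (l' != x.1))).
apply: (@leq_trans (\sum_(x in S) 2)); first by rewrite sum_nat_const (leq_mul2r 2 6) S6.
apply: leq_sum => -[l p]; rewrite inE /= => /andP[/andP[_ pl] _].
have := degree_ge3_point pl; rewrite (cardsD1 l) inE pl add1n ltnS.
by move=> /leq_trans -> //; apply/subset_leq_card/subsetP => l'; rewrite !inE andbC.
Qed.

(** The at least 12 paths of length 3 from p0 end in distinct lines, since two with the same end
    would close a quadrangle or a hexagon. Each of these lines is on at least 3 edges. *)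
Lemma hexagon_free_card l0 : hexagon_free -> (p0, l0) \in E -> 36 <= #|E|.
Proof.
move=> e6 /S2_card S12.
have S2_inj : {in S2 &, injective snd}.
  move=> [[l1 p1] l] [[l2 p2] l']; rewrite !inE /= => h1 h2 ll.
  move: h1 h2; rewrite -{l'}ll.
  move=> /andP[/andP[/andP[p0l1 p1l1] p10] /andP[p1l ll1]].
  move=> /andP[/andP[/andP[p0l2 p2l2] p20] /andP[p2l ll2]].
  have [l12|l12] := eqVneq l1 l2.
    subst l2; case: (e4 (Ee p1l1) (Ee p1l) (Ee p2l2) (Ee p2l)) => [-> //|E0].
    by rewrite E0 eqxx in ll1.
  have [p12|p12] := eqVneq p1 p2.
    subst p2; case: (e4 (Ee p1l1) (Ee p2l2) (Ee p0l1) (Ee p0l2)) => E0.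
      by rewrite E0 eqxx in p10.
    by rewrite E0 eqxx in l12.
  by case: (e6 p0 p1 p2 l1 l l2 _ _ p12 l12 ll1 ll2 (Ee p0l1) (Ee p1l1)
    (Ee p1l) (Ee p2l) (Ee p2l2) (Ee p0l2)); rewrite eq_sym.
rewrite -(card_in_imset S2_inj) in S12.
apply: leq_trans (card_ge_lines (D := snd @: S2) _).
  by rewrite (leq_mul2l 3 12).
by move=> _ /imsetP[[[l p] l'] + ->]; rewrite inE => /and3P[_ h _]; exists p.
Qed.

End FromPoint.

End IncidenceGraphs.

(** The only property of the graph that enters the proof that the construction has no cube product;
    girth serves to establish it. *)
Definition avoids_triple_degrees (P L : finType) (e : P -> L -> bool) (k : nat) : Prop :=
  forall E : {set P * L}, (forall p l, (p, l) \in E -> e p l) ->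
    triple_degrees E -> #|E| <= k -> E = set0.

Lemma set_pair_neq0 (P L : finType) (E : {set P * L}) :
  E = set0 \/ exists p l, (p, l) \in E.
Proof.
by have [->|[[p l] h]] := set_0Vmem E; [left|right; exists p, l].
Qed.

(** * Algebraic graphs of girth at least 6 and at least 8 *)

Section FiniteField.

Import GRing.Theory.
Local Open Scope ring_scope.

Variable F : finFieldType.

Definition line_graph (p l : F * F) : bool := p.2 + l.2 == p.1 * l.1.

(** A graph on q^3 points and q^3 lines without 4- and 6-cycles; the first equation alone is the
    incidence of points and non-vertical lines in the affine plane. *)
Definition quadrangle_graph (p l : F * F * F) : bool :=
  (p.1.2 + l.1.2 == p.1.1 * l.1.1) && (p.2 + l.2 == p.1.1 ^+ 2 * l.1.1).

(** A point and the slope of the line may be chosen freely and determine the edge. *)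
Lemma line_graph_card : #|[set x | line_graph x.1 x.2]| = (#|F| ^ 3)%N.
Proof.
pose f (x : F * F * F) : (F * F) * (F * F) := ((x.1.1, x.1.2), (x.2, x.1.1 * x.2 - x.1.2)).
have -> : [set x | line_graph x.1 x.2] = f @: [set: F * F * F].
  apply/setP => -[[a b] [x y]]; rewrite !inE /line_graph /=.
  apply/eqP/imsetP => [E|[[[a' b'] x'] _ [-> -> -> ->]]]; last by ring.
  by exists (a, b, x); rewrite ?in_setT // /f /= -E [b + y]addrC addrK.
rewrite card_imset; first by rewrite cardsT !card_prod !expnSr expn0 mul1n.
by move=> [[a b] x] [[a' b'] x'] [-> -> ->].
Qed.

Lemma quadrangle_graph_card :
  #|[set x | quadrangle_graph x.1 x.2]| = (#|F| ^ 4)%N.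
Proof.
pose f (x : F * F * F * F) : (F * F * F) * (F * F * F) := (x.1,
  (x.2, x.1.1.1 * x.2 - x.1.1.2, x.1.1.1 ^+ 2 * x.2 - x.1.2)).
have -> : [set x | quadrangle_graph x.1 x.2] = f @: [set: F * F * F * F].
  apply/setP => -[[[a b] c] [[x y] z]]; rewrite !inE /quadrangle_graph /=.
  apply/andP/imsetP => [[/eqP E1 /eqP E2]|[[[[a' b'] c'] x'] _ [-> -> -> -> -> ->]]].
    by exists (a, b, c, x); rewrite ?in_setT // /f /= -E1 -E2 [b + y]addrC [c + z]addrC !addrK.
  by split; apply/eqP => /=; ring.
rewrite card_imset; first by rewrite cardsT !card_prod !expnSr expn0 mul1n.
by move=> [[[a b] c] x] [[[a' b'] c'] x'] [-> -> -> ->].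
Qed.

Lemma no_quadrangle (a a' b b' x x' y y' : F) :
  b + y = a * x -> b + y' = a * x' -> b' + y = a' * x -> b' + y' = a' * x' ->
  a = a' \/ x = x'.
Proof.
move=> h1 h2 h3 h4.
have /eqP : (a - a') * (x - x') = 0.
  have -> : (a - a') * (x - x') = a * x - a * x' - (a' * x - a' * x') by ring.
  by rewrite -h1 -h2 -h3 -h4; ring.
by rewrite mulf_eq0 !subr_eq0 => /orP[] /eqP; [left|right].
Qed.

Lemma line_graph_quadrangle_free : quadrangle_free line_graph.
Proof.
move=> [a b] [a' b'] [x y] [x' y']; rewrite /line_graph /=.
move=> /eqP h1 /eqP h2 /eqP h3 /eqP h4.
have [aa|xx] := no_quadrangle h1 h2 h3 h4.
  left; rewrite -aa in h3 *; congr (_, _).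
  by apply: (addIr y); rewrite h1 h3.
right; rewrite -xx in h2 *; congr (_, _).
by apply: (addrI b); rewrite h1 h2.
Qed.

Lemma quadrangle_graph_point_inj p p' l : quadrangle_graph p l ->
  quadrangle_graph p' l -> p.1.1 = p'.1.1 -> p = p'.
Proof.
case: p p' l => [[a b] c] [[a' b'] c'] [[x y] z]; rewrite /quadrangle_graph /=.
move=> /andP[/eqP h1 /eqP h2] /andP[/eqP h3 /eqP h4] aa; rewrite -aa in h3 h4 *.
congr (_, _, _); first by apply: (addIr y); rewrite h1 h3.
by apply: (addIr z); rewrite h2 h4.
Qed.

Lemma quadrangle_graph_line_inj p l l' : quadrangle_graph p l ->
  quadrangle_graph p l' -> l.1.1 = l'.1.1 -> l = l'.
Proof.
case: p l l' => [[a b] c] [[x y] z] [[x' y'] z']; rewrite /quadrangle_graph /=.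
move=> /andP[/eqP h1 /eqP h2] /andP[/eqP h3 /eqP h4] xx; rewrite -xx in h3 h4 *.
congr (_, _, _); first by apply: (addrI b); rewrite h1 h3.
by apply: (addrI c); rewrite h2 h4.
Qed.

Lemma quadrangle_graph_quadrangle_free : quadrangle_free quadrangle_graph.
Proof.
move=> p p' l l' e1 e2 e3 e4.
have /andP[/eqP h1 _] := e1; have /andP[/eqP h2 _] := e2.
have /andP[/eqP h3 _] := e3; have /andP[/eqP h4 _] := e4.
have [aa|xx] := no_quadrangle h1 h2 h3 h4.
  by left; apply: quadrangle_graph_point_inj e1 e3 aa.
by right; apply: quadrangle_graph_line_inj e1 e2 xx.
Qed.

(** Around a hexagon the alternating sums of both equations vanish. Subtracting a1 + a2 times the
    first from the second eliminates x and leaves (a0 - a1)(a0 - a2)(x1 - x2) = 0, while vertices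
    sharing a neighbour differ in their first coordinates. *)
Lemma quadrangle_graph_hexagon_free : hexagon_free quadrangle_graph.
Proof.
move=> p0 p1 p2 l1 l l2 p01 p02 p12 l12 ll1 ll2 e1 e2 e3 e4 e5 e6.
have a01 : p0.1.1 != p1.1.1.
  by apply: contraNneq p01 => /(quadrangle_graph_point_inj e1 e2) ->.
have a02 : p0.1.1 != p2.1.1.
  by apply: contraNneq p02 => /(quadrangle_graph_point_inj e6 e5) ->.
have x12 : l1.1.1 != l2.1.1.
  by apply: contraNneq l12 => /(quadrangle_graph_line_inj e1 e6) ->.
move: e1 e2 e3 e4 e5 e6 a01 a02 x12; rewrite /quadrangle_graph.
case: p0 p1 p2 l1 l l2 {p01 p02 p12 l12 ll1 ll2} => [[a0 b0] c0] [[a1 b1] c1]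
  [[a2 b2] c2] [[x1 y1] z1] [[x y] z] [[x2 y2] z2] /=.
move=> /andP[/eqP h1 /eqP k1] /andP[/eqP h2 /eqP k2] /andP[/eqP h3 /eqP k3].
move=> /andP[/eqP h4 /eqP k4] /andP[/eqP h5 /eqP k5] /andP[/eqP h6 /eqP k6].
rewrite -subr_eq0 -[a0 == a2]subr_eq0 -[x1 == x2]subr_eq0 => a01 a02 x12.
have /eqP : (a0 - a1) * (a0 - a2) * (x1 - x2) = 0.
  have -> : (a0 - a1) * (a0 - a2) * (x1 - x2) =
    (a0 ^+ 2 * x1 - a1 ^+ 2 * x1 + a1 ^+ 2 * x - a2 ^+ 2 * x + a2 ^+ 2 * x2 - a0 ^+ 2 * x2)
    - (a1 + a2) * (a0 * x1 - a1 * x1 + a1 * x - a2 * x + a2 * x2 - a0 * x2) by ring.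
  by rewrite -h1 -h2 -h3 -h4 -h5 -h6 -k1 -k2 -k3 -k4 -k5 -k6; ring.
by rewrite !mulf_eq0 (negPf a01) (negPf a02) (negPf x12).
Qed.

End FiniteField.

Lemma line_graph_avoids (F : finFieldType) : avoids_triple_degrees (@line_graph F) 15.
Proof.
move=> E Ee E3 E15; have [//|[p [l pl]]] := set_pair_neq0 E.
have := quadrangle_free_card (@line_graph_quadrangle_free F) Ee E3 pl.
by move/leq_trans/(_ E15).
Qed.

Lemma quadrangle_graph_avoids (F : finFieldType) :
  avoids_triple_degrees (@quadrangle_graph F) 33.
Proof.
move=> E Ee E3 E33; have [//|[p [l pl]]] := set_pair_neq0 E.
have := hexagon_free_card (@quadrangle_graph_quadrangle_free F) Ee E3
  (@quadrangle_graph_hexagon_free F) pl.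
by move/leq_trans/(_ E33).
Qed.

(** * The construction for the lower bound *)

Lemma logn_prod_seq (p : nat) (r : seq nat) : all (leq 1) r ->
  logn p (\prod_(a <- r) a) = \sum_(a <- r) logn p a.
Proof.
elim: r => [|a r IHr]; first by rewrite !big_nil logn1.
move=> /andP[a0 r0]; rewrite !big_cons lognM ?IHr //.
elim: r r0 {IHr} => [|b r IHr] /=; rewrite ?big_nil // big_cons => /andP[b0 /IHr].
by rewrite muln_gt0 b0.
Qed.

Section Construction.

Variables (n s m : nat) (c : seq nat) (P L : finType) (e : P -> L -> bool).
Variable g : P + L -> nat.

Hypotheses (s_ge5 : 5 <= s) (sn : s ^ 2 <= n).
Hypotheses (c_uniq : uniq c) (c_sub : {subset c <= [:: 1; 2; 3; 5]}).
Hypotheses (g_inj : injective g) (g_prime : forall v, prime (g v)).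
Hypothesis g_range : forall v, 5 < g v <= s.
Hypothesis e_avoids : avoids_triple_degrees e (3 * m).
Hypothesis c_admissible : forall f : nat -> nat,
  (forall i, i \in c -> f i <= m) ->
  (forall i, i \in c -> i != 1 -> 3 %| f i) -> \sum_(i <- c) f i != 3 * m.

Let big_primes := [seq p <- iota s.+1 (n - s) | prime p].

Let base := [seq i * p | i <- c, p <- [seq p <- big_primes | i * p <= n]].

Let edges := [seq x <- enum {: P * L} | e x.1 x.2].

Let edge_val (x : P * L) := g (inl x.1) * g (inr x.2).

Let big_primeP p : p \in big_primes -> [/\ prime p, s < p & 5 < p].
Proof.
rewrite mem_filter mem_iota => /andP[pp /andP[sp _]]; split=> //.
exact: leq_ltn_trans sp.
Qed.

Let c_gt0 i : i \in c -> 0 < i <= 5.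
Proof. by move=> /c_sub; rewrite !inE => /or4P[] /eqP ->. Qed.

Let big_prime_dvd p q i : p \in big_primes -> q \in big_primes -> i \in c ->
  (p %| i * q) = (p == q).
Proof.
move=> /big_primeP[pp _ p5] /big_primeP[pq _ _] /c_gt0/andP[i0 i5].
rewrite Euclid_dvdM // [p %| q]dvdn_prime2 //.
suff /negPf-> : ~~ (p %| i) by [].
by apply/negP => pi; have := leq_trans p5 (leq_trans (dvdn_leq i0 pi) i5).
Qed.

Let edge_logn p x : prime p ->
  logn p (edge_val x) = (p == g (inl x.1)) + (p == g (inr x.2)).
Proof. move=> pp; rewrite /edge_val lognM; [|exact/prime_gt0/g_prime..].
by rewrite !(logn_prime _ (g_prime _)). Qed.

Let base_logn p i q : prime p -> i \in c -> q \in big_primes ->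
  logn p (i * q) = logn p i + (p == q).
Proof.
move=> pp ic /big_primeP[pq _ _]; have /andP[i0 _] := c_gt0 ic.
by rewrite lognM ?(prime_gt0 pq) // (logn_prime p pq).
Qed.

Let logn_c p i : prime p -> 5 < p -> i \in c -> logn p i = 0.
Proof.
move=> pp p5 /c_gt0/andP[i0 i5]; apply/eqP; rewrite -leqn0 leqNgt logn_gt0.
rewrite mem_primes pp i0 /=; apply/negP => pi.
by have := leq_trans p5 (leq_trans (dvdn_leq i0 pi) i5).
Qed.

Let all_vals := base ++ [seq edge_val x | x <- edges].

(** Unique factorization: a multiple i p is identified by its prime p > s, which divides no edge
    value, and an edge value by the labels of its two ends. *)
Let all_vals_uniq : uniq all_vals.
Proof.
rewrite cat_uniq; apply/and3P; split.
- apply: allpairs_uniq_dep => //.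
    by move=> i _; rewrite !filter_uniq ?iota_uniq.
  move=> x y /allpairsPdep[i [p [ic + ->]]] /allpairsPdep[j [q [jc + ->]]] /=.
  rewrite !mem_filter => /andP[_ pb] /andP[_ qb] ipq.
  rewrite -!mem_filter -/big_primes in pb qb.
  have /eqP pq : p == q by rewrite -(big_prime_dvd pb qb jc) -ipq dvdn_mull.
  have [pp _ _] := big_primeP pb.
  move: ipq; rewrite pq => /eqP; rewrite eqn_pmul2r; last first.
    by rewrite -pq prime_gt0.
  by move=> /eqP ->.
- apply/hasPn => _ /mapP[x _ ->]; apply/negP => /allpairsPdep[i [p [ic + E]]].
  rewrite mem_filter => /andP[_ pb]; have [pp sp _] := big_primeP pb.
  have := edge_logn x pp; rewrite E base_logn // eqxx addn1.
  have h v : (p == g v) = false.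
    by apply: contraTF sp => /eqP ->; have /andP[_] := g_range v; rewrite leqNgt.
  by rewrite !h.
rewrite map_inj_in_uniq ?filter_uniq -?enumT ?enum_uniq // => -[p l] [p' l'] _ _ E.
have := edge_logn (p, l) (g_prime (inl p)); have := edge_logn (p, l) (g_prime (inr l)).
rewrite E !edge_logn // /= !(inj_eq g_inj) !eqxx.
have inlr q (k : L) : (inl q == inr k :> P + L) = false by [].
have inrl q (k : L) : (inr k == inl q :> P + L) = false by [].
rewrite !inlr !inrl !addn0 !add0n -[inr l == _]/(l == l') -[inl p == _]/(p == p').
by do 2!case: eqP => // ->.
Qed.

Definition construction : {set 'I_n.+1} := [set a : 'I_n.+1 | (a : nat) \in all_vals].

Let all_vals_le a : a \in all_vals -> 0 < a <= n.
Proof.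
rewrite mem_cat => /orP[/allpairsPdep[i [p [ic + ->]]]|/mapP[x _ ->]].
  rewrite mem_filter => /andP[-> /big_primeP[pp _ _]].
  by have /andP[i0 _] := c_gt0 ic; rewrite muln_gt0 i0 prime_gt0.
rewrite muln_gt0 !prime_gt0 //= (leq_trans _ sn) // -mulnn.
have /andP[_ h1] := g_range (inl x.1); have /andP[_ h2] := g_range (inr x.2).
exact: leq_mul.
Qed.

Lemma construction_neq0 : ord0 \notin construction.
Proof. by rewrite inE; apply/negP => /all_vals_le. Qed.

(** For each i in c the base misses only primes up to s, at most s of them. *)
Lemma card_construction :
  \sum_(i <- c) nat_pi (n %/ i) + #|[set x : P * L | e x.1 x.2]|
    <= #|construction| + size c * s.
Proof.
have -> : #|construction| = size all_vals.
  rewrite cardE -(size_map val); apply/perm_size/uniq_perm => //.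
    by rewrite map_inj_uniq ?enum_uniq //; apply: val_inj.
  move=> a; apply/mapP/idP => [[b]|aV]; first by rewrite mem_enum inE => bV ->.
  have /andP[_ an] := all_vals_le aV.
  by exists (inord a); rewrite ?mem_enum ?inE /= inordK.
rewrite size_cat size_map addnAC leq_add //; last first.
  rewrite /edges size_filter cardE -sum1_size big_enum /= -sum1_count big_enum_cond /=.
  by rewrite leq_eqVlt; apply/orP; left; apply/eqP/eq_bigl => x; rewrite inE.
rewrite size_allpairs_dep sumnE big_map -sum1_size big_distrl -big_split /=.
rewrite big_seq [leqRHS]big_seq; apply: leq_sum => i ic; rewrite mul1n.
have /andP[i0 _] := c_gt0 ic.
rewrite /nat_pi -size_filter -[s in _ + s](size_iota 1) -size_cat.
apply: uniq_leq_size; first by rewrite filter_uniq ?iota_uniq.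
move=> p; rewrite mem_cat !mem_filter !mem_iota => /andP[pp /andP[_ pn]].
have p0 := prime_gt0 pp.
have ipn : i * p <= n by rewrite mulnC -leq_divRL.
have pn' : p <= n by rewrite (leq_trans _ ipn) // leq_pmull.
have sn' : s <= n.
  by rewrite (leq_trans _ sn) // -mulnn leq_pmull // (leq_trans _ s_ge5).
by rewrite pp ipn /=; lia.
Qed.

Section Product.

Variables (r : seq nat) (z : nat).
Hypotheses (r_uniq : uniq r) (r_size : size r = 3 * m).
Hypothesis rA : forall a, a \in r -> exists2 b, b \in construction & val b = a.
Hypothesis rz : \prod_(a <- r) a = z ^ 3.

Let r_vals : {subset r <= all_vals}.
Proof. by move=> a /rA[b + <-]; rewrite inE. Qed.

Let sum_r (f : nat -> nat) : \sum_(a <- r) f a =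
  \sum_(i <- c) \sum_(p <- big_primes | i * p \in r) f (i * p) +
  \sum_(x | e x.1 x.2 && (edge_val x \in r)) f (edge_val x).
Proof.
rewrite (perm_big [seq a <- all_vals | a \in r]) /=; last first.
  apply: uniq_perm; rewrite ?filter_uniq // => a.
  by rewrite mem_filter; case: (boolP (a \in r)) => // /r_vals ->.
rewrite big_filter big_cat /= big_map big_filter_cond big_enum_cond /=; congr (_ + _).
rewrite big_mkcond big_allpairs_dep; apply: eq_bigr => i _.
rewrite big_filter -big_mkcondr; apply: eq_bigl => p.
by case: (boolP (i * p \in r)) => [/r_vals/all_vals_le/andP[_ ->]|]; rewrite ?andbF.
Qed.

Let dvd3_logn p : 3 %| \sum_(a <- r) logn p a.
Proof.
rewrite -logn_prod_seq ?rz ?lognX ?dvdn_mulr //.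
by apply/allP => a /r_vals/all_vals_le/andP[].
Qed.

Let E := [set x : P * L | e x.1 x.2 && (edge_val x \in r)].

(** The label [g v] lies in (5, s] and so divides no multiple i p. Its valuation in the cube is
    therefore the degree of v in E. *)
Let dvd3_vertex v : 3 %| \sum_(x in E) ((v == inl x.1) + (v == inr x.2)).
Proof.
have := dvd3_logn (g v); rewrite sum_r big_seq big1 ?add0n => [|i ic].
  rewrite (eq_bigl (mem E)) => [|x]; last by rewrite !inE.
  under eq_bigr do rewrite edge_logn // !(inj_eq g_inj).
  by [].
rewrite big_seq_cond big1 // => p /andP[pb _].
have /andP[v5 vs] := g_range v; have [_ sp _] := big_primeP pb.
rewrite base_logn // logn_c //; case: eqP => // gp.
by move: sp; rewrite -gp ltnNge vs.
Qed.

Let E_triple : triple_degrees E.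
Proof.
split=> [p|l].
  have := dvd3_vertex (inl p); congr (3 %| _).
  rewrite (eq_bigr (fun x => (x.1 == p) : nat)) => [|x _]; last first.
    by rewrite addn0 -[inl p == _]/(p == x.1) eq_sym.
  have pair_inj : injective (pair p : L -> P * L) by move=> l l' [].
  rewrite -big_mkcondr sum1dep_card -(card_imset _ pair_inj).
  apply: eq_card => -[q l]; rewrite inE; apply/andP/imsetP => [[qE /eqP /= qp]|].
    by exists l; [rewrite inE -qp | rewrite qp].
  by case=> k; rewrite inE => pk [-> ->].
have := dvd3_vertex (inr l); congr (3 %| _).
rewrite (eq_bigr (fun x => (x.2 == l) : nat)) => [|x _]; last first.
  by rewrite add0n -[inr l == _]/(l == x.2) eq_sym.
have pair_inj : injective ((fun p => (p, l)) : P -> P * L) by move=> p p' [].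
rewrite -big_mkcondr sum1dep_card -(card_imset _ pair_inj).
apply: eq_card => -[p k]; rewrite inE; apply/andP/imsetP => [[pE /eqP /= kl]|].
  by exists p; [rewrite inE -kl | rewrite kl].
by case=> q; rewrite inE => qk [-> ->].
Qed.

Let E_eq0 : E = set0.
Proof.
apply: e_avoids E_triple _ => [p l|]; first by rewrite inE => /andP[].
rewrite -r_size -sum1_size sum_r -sum1dep_card; exact: leq_addl.
Qed.

Let sum_base (f : nat -> nat) : \sum_(a <- r) f a =
  \sum_(i <- c) \sum_(p <- big_primes | i * p \in r) f (i * p).
Proof.
rewrite sum_r [X in _ + X]big1 ?addn0 // => x xE.
by have := in_set0 x; rewrite -E_eq0 inE xE.
Qed.

Let mult i := \sum_(p <- big_primes | i * p \in r) 1.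

(** No edges are left, so r consists of multiples i p. Valuations at 2, 3, 5 and at the primes p > s
    contradict [c_admissible] for f = [mult]. *)
Lemma construction_product_false : False.
Proof.
have sum_mult : \sum_(i <- c) mult i = 3 * m by rewrite -r_size -sum1_size sum_base.
have mult_dvd i : i \in c -> i != 1 -> 3 %| mult i.
  move=> ic i1; have pi : prime i by move: (c_sub ic) i1; rewrite !inE => /or4P[] /eqP ->.
  have := dvd3_logn i; rewrite sum_base (bigD1_seq i) //= [X in _ + X]big_seq_cond.
  rewrite [X in _ + X]big1 ?addn0.
    congr (3 %| _); rewrite /mult big_seq_cond [RHS]big_seq_cond.
    apply: eq_bigr => p /andP[pb _].
    rewrite base_logn // logn_prime // eqxx; case: eqP => // ip.
    by have [_ _] := big_primeP pb; have /andP[_] := c_gt0 ic; rewrite -ip leqNgt => /negPf ->.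
  move=> j /andP[jc ji]; rewrite big_seq_cond big1 // => p /andP[pb _].
  rewrite base_logn //; case: eqP => [ip|_].
    by have [_ _] := big_primeP pb; have /andP[_] := c_gt0 ic; rewrite -ip leqNgt => /negPf ->.
  by move: (c_sub ic) (c_sub jc) i1 ji; rewrite !inE => /or4P[] /eqP -> /or4P[] /eqP ->.
(* The number of multiples of p in r, which is the valuation of the product at p. *)
pose hits p := \sum_(i <- c | i * p \in r) 1.
have hits_dvd p : p \in big_primes -> 3 %| hits p.
  move=> pb; have [pp _ p5] := big_primeP pb; have := dvd3_logn p; rewrite sum_base.
  congr (3 %| _); rewrite /hits [RHS]big_mkcond /= big_seq [RHS]big_seq.
  apply: eq_bigr => i ic; rewrite big_mkcond (bigD1_seq p) ?filter_uniq ?iota_uniq //=.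
  rewrite [X in _ + X]big_seq_cond [X in _ + X]big1 => [|q /andP[qb qp]].
    by rewrite addn0 base_logn // logn_c // eqxx.
  by rewrite base_logn // logn_c // eq_sym (negPf qp); case: ifP.
have sum_hits : \sum_(p <- big_primes) hits p = 3 * m.
  rewrite -sum_mult /mult /hits; under eq_bigr do rewrite big_mkcond.
  rewrite exchange_big; apply: eq_bigr => i _; exact/esym/big_mkcond.
(* Every p counted by [mult i] has at least 3 hits, and there are 3m hits in all. *)
have mult_le i : i \in c -> mult i <= m.
  move=> ic; rewrite -(leq_pmul2l (isT : 0 < 3)) -sum_hits /mult big_distrr /=.
  rewrite big_mkcond big_seq [leqRHS]big_seq; apply: leq_sum => p pb.
  case: ifP => // ipr; apply: dvdn_leq (hits_dvd p pb).
  by rewrite /hits big_mkcond (bigD1_seq i) //= ipr.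
by have := c_admissible mult_le mult_dvd; rewrite sum_mult eqxx.
Qed.

End Product.

Lemma construction_no_cube : no_cube_product (3 * m) construction.
Proof. by move=> r z ru rs rA rz; apply: (construction_product_false ru rs rA rz). Qed.

End Construction.

(* Bounds for F_{k,3}(n) in natural numbers *)
From mathcomp Require Import all_classical all_reals all_analysis.

(** Sorting a duplicate-free list gives the increasing tuple; conversely an integer root is replaced
    by its absolute value, the product being nonnegative. *)
Lemma no_power_productP (k n : nat) (A : {set 'I_n.+1}) :
  no_power_product k 3 A <-> no_cube_product k A.
Proof.
rewrite /no_power_product; split=> [nA s z us sk sA sz|nA [a [x [aA alt ax]]]].
  pose s' := sort leq s; have s'k : size s' = k by rewrite size_sort.
  have s'n i : i < k -> nth 0 s' i \in s by rewrite -(mem_sort leq) -s'k; apply: mem_nth.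
  pose f i : 'I_n.+1 := inord (nth 0 s' i).
  have fE i : i < k -> f i = nth 0 s' i :> nat.
    by move=> /s'n/sA[b _ E]; rewrite /f -E inordK //; apply: ltn_ord.
  apply: nA; exists [tuple f i | i < k], (Posz z); split.
  - move=> _ /tnthP[i ->]; rewrite tnth_mktuple.
    have [b bA E] := sA _ (s'n i (ltn_ord i)).
    by rewrite (_ : f i = b) //; apply/val_inj; rewrite /= fE.
  - move=> i j ij; rewrite !tnth_mktuple !fE //.
    have : sorted ltn s'.
      by rewrite ltn_sorted_uniq_leq sort_uniq us sort_sorted //; apply: leq_total.
    move=> /(sorted_ltn_nth ltn_trans 0); apply=> //; rewrite inE s'k //.
  rewrite -[RHS]/(Posz (z ^ 3)) -sz -(perm_big _ (permEl (perm_sort leq s))) /=.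
  rewrite -/s' (big_nth 0) s'k big_mkord.
  rewrite (big_morph Posz PoszM (erefl 1%Z)); apply: eq_bigr => i _.
  by rewrite tnth_mktuple fE.
apply: (nA [seq val i | i <- a] `|x|).
- rewrite map_inj_uniq; last exact: val_inj.
  apply/tuple_uniqP => i j aij; apply/val_inj; have := alt i j; have := alt j i.
  by rewrite aij ltnn; case: ltngtP => // _ => [/(_ isT)|_ /(_ isT)].
- by rewrite size_map size_tuple.
- by move=> _ /mapP[b ba ->]; exists b => //; apply: aA.
rewrite big_map -abszX -ax big_tuple.
by rewrite (big_morph absz abszM (erefl (absz 1))).
Qed.

Lemma Fmax_leP (k n c : nat) :
  (forall A : {set 'I_n.+1}, ord0 \notin A -> no_cube_product k A -> #|A| <= c) ->
  Fmax k 3 n <= c.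
Proof.
by move=> h; apply/bigmax_leqP => A /andP[A0 /asboolP/no_power_productP]; apply: h.
Qed.

Lemma leq_Fmax (k n : nat) (A : {set 'I_n.+1}) :
  ord0 \notin A -> no_cube_product k A -> #|A| <= Fmax k 3 n.
Proof.
move=> A0 nA; rewrite /Fmax.
apply: (@leq_bigmax_cond _ _ (fun A : {set 'I_n.+1} => #|A|)).
by rewrite A0; apply/asboolP/no_power_productP.
Qed.

Definition pi_sum (c : seq nat) (n : nat) : nat := \sum_(i <- c) nat_pi (n %/ i).

Lemma Fmax_upper (m w : nat) (t : seq (seq nat)) : 2 < w <= 5 -> design m w t ->
  exists C, forall n T, 0 < T -> n < T ^ 6 ->
    Fmax (3 * m) 3 n <= pi_sum (iota 1 w.-1) n + C * T ^ 5.
Proof.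
move=> /andP[w3 w5] tP; exists (2 * w ^ 2 + 16 * (1 + 2 * m ^ 2) + m) => n T T0 nT.
by apply: Fmax_leP => A A0 /(card_le_consecutive T0 nT A0 w3 w5 tP).
Qed.

(** The design consists of the five cyclic intervals of length 3 modulo 5. Four indices do not
    suffice for m = 5: each would be omitted 2 modulo 3 times, at least 8 omissions in all. *)
Lemma Fmax_upper_15 : exists C, forall n T, 0 < T -> n < T ^ 6 ->
  Fmax 15 3 n <= pi_sum [:: 1; 2; 3; 5] n + C * T ^ 5.
Proof.
have tP : design 5 5 [:: [:: 0; 1; 2]; [:: 1; 2; 3]; [:: 2; 3; 4];
  [:: 3; 4; 0]; [:: 4; 0; 1]] by [].
exists (2 * 5 ^ 2 + 16 * (1 + 2 * 5 ^ 2) + 2 * 5) => n T T0 nT.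
by apply: Fmax_leP => A A0 nA; apply: (card_le_1235 T0 nT A0 _ _ tP).
Qed.

(* With w = 4, the i-th triple omits one of the four indices; the numbers of
   omissions c_0, ..., c_3 sum to m and satisfy c_i = m mod 3. *)
Definition omit_design (c : seq nat) : seq (seq nat) :=
  nseq (nth 0 c 0) [:: 1; 2; 3] ++ nseq (nth 0 c 1) [:: 0; 2; 3] ++
  nseq (nth 0 c 2) [:: 0; 1; 3] ++ nseq (nth 0 c 3) [:: 0; 1; 2].

Lemma design_exists :
  [/\ exists t, design 4 4 t, exists t, design 6 3 t, exists t, design 7 4 t,
      exists t, design 8 4 t & [/\ exists t, design 9 3 t,
      exists t, design 10 4 t & exists t, design 11 4 t]].
Proof.
split; last split.
- by exists (omit_design [:: 1; 1; 1; 1]).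
- by exists (nseq 6 [:: 0; 1; 2]).
- by exists (omit_design [:: 4; 1; 1; 1]).
- by exists (omit_design [:: 2; 2; 2; 2]).
- by exists (nseq 9 [:: 0; 1; 2]).
- by exists (omit_design [:: 4; 4; 1; 1]).
- by exists (omit_design [:: 5; 2; 2; 2]).
Qed.

Lemma prime_labelling (V : finType) (s : nat) : 5 <= s -> #|V| + 3 <= nat_pi s ->
  exists g : V -> nat,
    [/\ injective g, forall v, prime (g v) & forall v, 5 < g v <= s].
Proof.
move=> s5 Vs; pose ps := [seq p <- iota 6 (s - 5) | prime p].
have ps_size : #|V| <= size ps.
  rewrite -(leq_add2r 3) (leq_trans Vs) // /nat_pi size_filter addnC.
  by rewrite -[s.+1](subnKC (s5 : 6 <= s.+1)) subSS iotaD count_cat leq_add2r.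
have gps (v : V) : nth 0 ps (enum_rank v) \in ps.
  by apply: mem_nth; apply: leq_trans (ltn_ord _) ps_size.
exists (fun v => nth 0 ps (enum_rank v)); split.
- move=> u v /eqP; rewrite nth_uniq ?filter_uniq ?iota_uniq //.
  + by move=> /eqP/ord_inj/enum_rank_inj.
  + by rewrite (leq_trans (ltn_ord (enum_rank u))).
  + by rewrite (leq_trans (ltn_ord (enum_rank v))).
- by move=> v; move: (gps v); rewrite mem_filter => /andP[].
move=> v; move: (gps v); rewrite mem_filter mem_iota => /andP[_]; lia.
Qed.

(** Here f i stands for the number of elements i p in a product of 3m elements; the valuation at a
    prime i makes it a multiple of 3. *)
Definition admissible (c : seq nat) (m : nat) : Prop := forall f : nat -> nat,
  (forall i, i \in c -> f i <= m) ->
  (forall i, i \in c -> i != 1 -> 3 %| f i) -> \sum_(i <- c) f i != 3 * m.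

Lemma Fmax_lower (P L : finType) (e : P -> L -> bool) (c : seq nat) (m n s : nat) :
  uniq c -> {subset c <= [:: 1; 2; 3; 5]} -> admissible c m ->
  avoids_triple_degrees e (3 * m) ->
  5 <= s -> s ^ 2 <= n -> #|P| + #|L| + 3 <= nat_pi s ->
  pi_sum c n + #|[set x : P * L | e x.1 x.2]| <= Fmax (3 * m) 3 n + size c * s.
Proof.
move=> cu cs cm ek s5 sn PL.
have [|g [g_inj g_prime g_range]] := @prime_labelling (P + L)%type s s5.
  by rewrite card_sum.
apply: leq_trans (card_construction e s5 sn cu cs g_inj g_prime g_range) _.
rewrite leq_add2r; apply: leq_Fmax.
  exact: (construction_neq0 e s5 sn cs g_prime g_range).
exact: (construction_no_cube s5 sn cu cs g_inj g_prime g_range ek cm).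
Qed.

Lemma avoids_leq (P L : finType) (e : P -> L -> bool) (k k' : nat) :
  k <= k' -> avoids_triple_degrees e k' -> avoids_triple_degrees e k.
Proof. by move=> kk ek E Ee E3 Ek; apply: ek => //; apply: leq_trans kk. Qed.

(** With q = 2^k there are 2 q^2 vertices to label and q^3 edges gained; m <= 5 keeps 3m below the
    18 edges forced by girth 6. *)
Lemma Fmax_lower_line (c : seq nat) (m : nat) :
  uniq c -> {subset c <= [:: 1; 2; 3; 5]} -> admissible c m -> m <= 5 ->
  forall n s k, 0 < k -> 5 <= s -> s ^ 2 <= n -> 2 * (2 ^ k) ^ 2 + 3 <= nat_pi s ->
  pi_sum c n + (2 ^ k) ^ 3 <= Fmax (3 * m) 3 n + size c * s.
Proof.
move=> cu cs cm m5 n s k k0 s5 sn qs.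
have [F _ Fq] := @PrimePowerField 2 k isT k0.
rewrite -Fq -line_graph_card; apply: Fmax_lower => //.
  by apply: avoids_leq (@line_graph_avoids F); rewrite (leq_mul2l 3 m 5).
by rewrite !card_prod Fq addnn -mul2n.
Qed.

Lemma Fmax_lower_quadrangle (c : seq nat) (m : nat) :
  uniq c -> {subset c <= [:: 1; 2; 3; 5]} -> admissible c m -> m <= 11 ->
  forall n s k, 0 < k -> 5 <= s -> s ^ 2 <= n -> 2 * (2 ^ k) ^ 3 + 3 <= nat_pi s ->
  pi_sum c n + (2 ^ k) ^ 4 <= Fmax (3 * m) 3 n + size c * s.
Proof.
move=> cu cs cm m11 n s k k0 s5 sn qs.
have [F _ Fq] := @PrimePowerField 2 k isT k0.
rewrite -Fq -quadrangle_graph_card; apply: Fmax_lower => //.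
  by apply: avoids_leq (@quadrangle_graph_avoids F); rewrite (leq_mul2l 3 m 11).
by rewrite !card_prod Fq addnn -mul2n -[2 ^ k * _ * _]mulnA.
Qed.

Lemma admissible_12 m : 0 < m -> admissible [:: 1; 2] m.
Proof.
move=> m0 f fm _; rewrite !big_cons big_nil.
by have := fm 1 isT; have := fm 2 isT; lia.
Qed.

(** A sum of 3m forces every f i to equal m, but 3 divides f 2. *)
Lemma admissible_123 m : ~~ (3 %| m) -> admissible [:: 1; 2; 3] m.
Proof.
move=> m3 f fm f3; rewrite !big_cons big_nil; apply/eqP => E.
have := fm 1 isT; have := fm 2 isT; have := fm 3 isT => h3 h2 h1.
by case/negP: m3; rewrite (_ : m = f 2) ?f3 //; lia.
Qed.

(** A multiple of 3 that is at most 5 is at most 3, so the sum is at most 5 + 3 + 3 + 3 = 14 <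
    15. *)
Lemma admissible_1235 : admissible [:: 1; 2; 3; 5] 5.
Proof.
move=> f fm f3; rewrite !big_cons big_nil.
have := fm 1 isT; have := fm 2 isT; have := fm 3 isT; have := fm 5 isT.
have := f3 2 isT isT; have := f3 3 isT isT; have := f3 5 isT isT; lia.
Qed.

(** * Real estimates *)

Import Order.TTheory GRing.Theory Num.Theory.
Local Open Scope classical_set_scope.
Local Open Scope ring_scope.

Section RealBounds.

Variable R : realType.

Lemma prime_pi_div (n c : nat) : (0 < c)%N ->
  prime_pi (n%:R / c%:R : R) = nat_pi (n %/ c).
Proof.
move=> c0; rewrite /prime_pi /nat_pi; congr (count prime (iota 0 _.+1)).
have c0' : 0 < c%:R :> R by rewrite ltr0n.
apply/eqP; rewrite truncn_eq ?divr_ge0 ?ler0n // ler_pdivlMr // ltr_pdivrMr //.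
by rewrite -!natrM ler_nat ltr_nat leq_trunc_div ltn_ceil.
Qed.

Lemma prime_pi_nat (n : nat) : prime_pi (n%:R : R) = nat_pi n.
Proof. by rewrite -[n%:R]divr1 (prime_pi_div n (isT : (0 < 1)%N)) divn1. Qed.

Lemma vinogradov_upper (k : nat) (c : seq nat) :
  (exists C, forall n T, (0 < T)%N -> (n < T ^ 6)%N ->
     (Fmax k 3 n <= pi_sum c n + C * T ^ 5)%N) ->
  vinogradov_le (fun n => (Fmax k 3 n)%:R - (pi_sum c n)%:R : R)
    (fun n => n%:R `^ (5 / 6)).
Proof.
move=> [C FC]; exists (C.+1 * 32)%:R; first by rewrite ltr0n.
near=> n.
have n0 : (0 < n)%N by near: n; exact: nbhs_infty_gt.
have exT : exists T, (n < T ^ 6)%N.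
  exists n.+1; apply: leq_trans (leq_pexp2l _ (isT : (1 <= 6)%N)) => //.
(* For the least such T, (T - 1)^6 <= n and T <= 2 (T - 1), so T^5 <= 2^5 n^(5/6). *)
have [T nT minT] := ex_minnP exT.
have T0 : (0 < T)%N by move: nT; case: (T).
have T1 : (0 < T.-1)%N.
  move: nT; case: (T) T0 => // -[|//] _; rewrite exp1n; lia.
have Tn : (T.-1 ^ 6 <= n)%N.
  by rewrite leqNgt; apply/negP => /minT; lia.
have T5 : (T.-1 ^ 5)%:R <= n%:R `^ (5 / 6) :> R.
  have -> : (T.-1 ^ 5)%:R = ((T.-1 ^ 6)%:R : R) `^ (5 / 6).
    by rewrite !natrX -!powR_mulrn ?ler0n // -powRrM; congr (_ `^ _); field.
  have h56 : 0 <= 5 / 6 :> R by lra.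
  by apply: (ge0_ler_powR h56); rewrite ?nnegrE ?ler0n ?ler_nat.
have TT : (T ^ 5 <= 32 * T.-1 ^ 5)%N.
  by rewrite -[32%N]/(2 ^ 5)%N -expnMn leq_exp2r //; lia.
rewrite lerBlDl; apply: (@le_trans _ _ (pi_sum c n + C * T ^ 5)%:R).
  by rewrite ler_nat FC.
rewrite natrD lerD2l.
apply: (@le_trans _ _ ((C.+1 * 32)%:R * (T.-1 ^ 5)%:R)); last first.
  by rewrite ler_wpM2l ?ler0n.
by rewrite -natrM ler_nat -mulnA leq_mul.
Unshelve. all: by end_near. Qed.

Lemma ln2_ge : 2^-1 <= ln (2 : R).
Proof.
have := @le_ln1Dx R (- 2^-1); have -> : 1 + - 2^-1 = 2^-1 :> R by field.
rewrite lnV ?posrE //; move=> /(_ _); rewrite lerNl opprK; apply; lra.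
Qed.

(** [chebyshev_lower] at k = s./2 with s the integer part of y, where ln s <= ln n. The condition y
    >= 8 absorbs the rounding, and ln 2 >= 1/2. *)
Lemma nat_pi_lower (n : nat) (y : R) : y = Num.sqrt n%:R -> 8 <= y -> 1 <= ln (n%:R : R) ->
  y / ln n%:R <= 8 * (nat_pi (Num.truncn y))%:R.
Proof.
move=> yE y8 L1; set s := Num.truncn y; set L := ln n%:R in L1 *.
have y0 : 0 <= y by lra.
have /andP[sy ys] : s%:R <= y < s.+1%:R := truncn_itv y0.
have k0 : (0 < s./2)%N.
  rewrite half_gt0 -(ltr_nat R); move: ys; rewrite -natr1; lra.
have s0 : (0 < s)%N by move: k0; rewrite half_gt0; apply: ltn_trans.
have n1 : 1 <= (n%:R : R).
  by rewrite ler1n lt0n; apply: contraTneq L1 => n0; rewrite /L n0 ln0 // -ltNge ltr01.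
have sn : s%:R <= (n%:R : R).
  apply: (le_trans sy); rewrite yE -[leRHS]sqr_sqrtr ?ler0n //.
  rewrite -yE expr2; nra.
have Cb : (2 ^ s./2 <= s ^ nat_pi s)%N.
  have ks : ((s./2).*2 <= s)%N by rewrite -[leqRHS]odd_double_half leq_addl.
  apply: leq_trans (chebyshev_lower k0) _.
  apply: (@leq_trans (s ^ nat_pi (s./2).*2)).
    by case: (nat_pi _) => // e; rewrite leq_exp2r.
  rewrite leq_pexp2l // /nat_pi -[in leqRHS](subnKC (ks : ((s./2).*2.+1 <= s.+1)%N)).
  by rewrite iotaD count_cat leq_addr.
have : (s./2)%:R * ln 2 <= (nat_pi s)%:R * L :> R.
  have : ln ((2 ^ s./2)%:R : R) <= ln ((s ^ nat_pi s)%:R : R).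
    by rewrite ler_ln ?posrE ?ltr0n ?expn_gt0 ?s0 // ler_nat.
  rewrite !natrX !lnXn ?ltr0n // -[ln 2 *+ _]mulr_natl -[ln _ *+ nat_pi s]mulr_natl.
  move=> /le_trans; apply.
  rewrite ler_wpM2l ?ler0n // /L ler_ln ?posrE ?ltr0n //; last first.
    by rewrite -(ltr0n R); lra.
move=> h; rewrite ler_pdivrMr; last by lra.
have s2 : s%:R <= 2 * (s./2)%:R + 1 :> R.
  rewrite -natrM natr1 ler_nat mul2n -[leqLHS]odd_double_half -add1n leq_add2r.
  by case: odd.
have := ln2_ge; move: ys; rewrite -natr1; nra.
Qed.

Lemma ln_growth (C : R) :
  \forall n \near \oo, C * ln (n%:R : R) ^+ 4 <= Num.sqrt n%:R.
Proof.
near=> n.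
(* Then ln n = 16 ln x <= 16 x, so the left side is O(x^4), against sqrt n = x^8. *)
pose x := (n%:R : R) `^ 16^-1.
have n1 : 1 <= (n%:R : R) by near: n; exact: nbhs_infty_ger.
have x16 : x ^+ 16 = n%:R.
  by rewrite -powR_mulrn ?powR_ge0 // -powRrM mulVf ?powRr1 ?ler0n.
have x0 : 0 < x by rewrite powR_gt0; lra.
have sq : Num.sqrt n%:R = x ^+ 8.
  by rewrite -x16 -[16%N]/(8 * 2)%N exprM sqrtr_sqr ger0_norm // exprn_ge0 // ltW.
have L0 : 0 <= ln (n%:R : R) by rewrite ln_ge0.
have L16 : ln (n%:R : R) <= 16 * x.
  rewrite -x16 lnXn // -[ln x *+ 16]mulr_natl ler_wpM2l // ltW // ln_sublinear //.
rewrite sq; apply: (@le_trans _ _ (`|C| * (16 * x) ^+ 4)).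
  apply: (le_trans (ler_norm _)); rewrite normrM ler_wpM2l // ger0_norm ?exprn_ge0 //.
  by rewrite lerXn2r // nnegrE mulr_ge0 // ltW.
have x4 : 0 <= x ^+ 4 by rewrite exprn_ge0 // ltW.
rewrite exprMn mulrA [x ^+ 8](exprD x 4 4) ler_wpM2r //.
have : (`|C| * 16 ^+ 4) ^+ 4 <= n%:R by near: n; exact: nbhs_infty_ger.
by rewrite -x16 (exprM x 4 4) ler_pXn2r ?nnegrE // mulr_ge0 ?exprn_ge0.
Unshelve. all: by end_near. Qed.

Lemma max_power_of_two (r N : nat) : (2 * 2 ^ r + 3 <= N)%N -> (0 < r)%N ->
  exists k, [/\ (0 < k)%N, (2 * (2 ^ k) ^ r + 3 <= N)%N
    & (N < 2 * (2 ^ k.+1) ^ r + 3)%N].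
Proof.
move=> N1 r0; have exk : exists k, (2 * (2 ^ k) ^ r + 3 <= N)%N by exists 1.
have bnd k : (2 * (2 ^ k) ^ r + 3 <= N)%N -> (k <= N)%N.
  move=> h; apply: leq_trans (leq_trans (_ : k <= 2 ^ k)%N _) h.
    exact/ltnW/ltn_expl.
  rewrite (leq_trans _ (leq_addr _ _)) // (leq_trans _ (leq_pmull _ _)) //.
  by rewrite -{1}[(2 ^ k)%N]expn1 leq_pexp2l // expn_gt0.
have [k kN kmax] := ex_maxnP exk bnd; exists k; split=> //; first exact: kmax.
by rewrite ltnNge; apply/negP => /kmax; rewrite ltnn.
Qed.

(** From y >= C0 L^4 follows z >= 512 256^3 L^3, which is what (8 y)^3 = 512 256^3 L^3 z^3 <= z^4
    requires in the case r = 3. *)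
Let C0 : R := 512 * 256 ^+ 4.

(* With Q = sqrt n / ln n there are at least Q / 8 primes up to sqrt n, so q can
   be chosen with q^r >= Q / 256, and q^(r+1) >= 8 sqrt n for large n. *)
Lemma power_of_two_bounds (r n : nat) (y z : R) : (r == 2) || (r == 3) ->
  y = Num.sqrt n%:R -> 1 <= ln (n%:R : R) -> z = y / ln n%:R / 256 ->
  C0 * ln (n%:R : R) ^+ 4 <= y ->
  8 <= y /\ exists k, [/\ (0 < k)%N, 1 <= z,
    (2 * (2 ^ k) ^ r + 3 <= nat_pi (Num.truncn y))%N,
    z <= ((2 ^ k) ^ r)%:R & 8 * y <= ((2 ^ k) ^ r.+1)%:R].
Proof.
move=> r23 yE; set L := ln n%:R => L1 zE yL.
have L3 : 1 <= L ^+ 3 by rewrite exprn_ege1.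
have L0 : 0 < L by lra.
have C00 : 0 < C0 by rewrite /C0 mulr_gt0 ?exprn_gt0 ?ltr0n.
have zL : z * (256 * L) = y by rewrite zE; field; lra.
have yL' : C0 / 256 * L ^+ 3 <= z.
  rewrite -(ler_pM2r (_ : 0 < 256 * L)) ?zL; last by lra.
  by apply: le_trans yL; rewrite le_eqVlt; apply/orP; left; apply/eqP; field.
have C0E : C0 / 256 = 512 * 256 ^+ 3 by rewrite /C0; field.
have c_gt0 : 0 < 512 * 256 ^+ 3 :> R by lra.
have z1 : 512 * 256 ^+ 3 <= z.
  apply: le_trans yL'; rewrite C0E; exact: ler_peMr (ltW c_gt0) L3.
have z0 : 0 <= z := le_trans (ltW c_gt0) z1.
have y8 : 8 <= y by rewrite -zL; nra.
have := nat_pi_lower yE y8 L1; rewrite -/L.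
have -> : y / L = 256 * z by rewrite zE; field; lra.
set N := nat_pi _ => zN.
have N19 : (2 * 2 ^ r + 3 <= N)%N.
  have h : (2 * 2 ^ r + 3 <= 19)%N by case/orP: r23 => /eqP ->.
  by apply: (leq_trans h); rewrite -(ler_nat R); nra.
have r0 : (0 < r)%N by case/orP: r23 => /eqP ->.
have [k [k0 kN Nk]] := max_power_of_two N19 r0.
have zq : z <= ((2 ^ k) ^ r)%:R.
  have : N%:R <= 16 * ((2 ^ k) ^ r)%:R + 3 :> R.
    rewrite -natrM -natrD ler_nat; apply: (leq_trans (ltnW Nk)).
    rewrite leq_add2r expnS expnMn mulnA leq_mul2r.
    by case/orP: r23 => /eqP ->; rewrite orbT.
  nra.
split=> //; exists k; split=> //; first by nra.
have q0 : 0 <= ((2 ^ k) ^ r.+1)%:R :> R by rewrite ler0n.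
have y0 : 0 <= y by lra.
case/orP: r23 => /eqP rE; rewrite rE in zq q0 *.
  have h : z ^+ 3 <= (((2 ^ k) ^ 3)%:R : R) ^+ 2.
    have -> : (((2 ^ k) ^ 3)%:R : R) ^+ 2 = ((2 ^ k) ^ 2)%:R ^+ 3.
      by rewrite !natrX -!exprM.
    by apply: lerXn2r; rewrite ?nnegrE ?ler0n //.
  rewrite -(ler_pXn2r (isT : (0 < 2)%N)) ?nnegrE ?mulr_ge0 //.
  apply: le_trans h; rewrite -zL exprMn.
  have -> : z ^+ 3 = z ^+ 2 * z by rewrite exprSr.
  have -> : 8 ^+ 2 * (z * (256 * L)) ^+ 2 = z ^+ 2 * (8 ^+ 2 * 256 ^+ 2 * L ^+ 2) :> R by ring.
  rewrite ler_wpM2l ?sqr_ge0 // (le_trans _ yL') // C0E.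
  have -> : 512 * 256 ^+ 3 * L ^+ 3 = (512 * 256 * L) * (256 ^+ 2 * L ^+ 2) :> R by ring.
  have hL : 8 ^+ 2 <= 512 * 256 * L by lra.
  rewrite -mulrA; apply: ler_wpM2r hL.
  by apply: mulr_ge0; [apply/exprn_ge0/ler0n|apply/exprn_ge0/ltW].
have h : z ^+ 4 <= (((2 ^ k) ^ 4)%:R : R) ^+ 3.
  have -> : (((2 ^ k) ^ 4)%:R : R) ^+ 3 = ((2 ^ k) ^ 3)%:R ^+ 4.
    by rewrite !natrX -!exprM.
  by apply: lerXn2r; rewrite ?nnegrE ?ler0n //.
rewrite -(ler_pXn2r (isT : (0 < 3)%N)) ?nnegrE ?mulr_ge0 //.
apply: le_trans h; rewrite -zL exprMn.
have -> : z ^+ 4 = z ^+ 3 * z by rewrite exprSr.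
have -> : 8 ^+ 3 * (z * (256 * L)) ^+ 3 = z ^+ 3 * (512 * 256 ^+ 3 * L ^+ 3) :> R by ring.
by rewrite ler_wpM2l ?exprn_ge0 -?C0E //; nra.
Qed.

(** With q = 2^k, the error K s <= 4 sqrt n is at most half of q^(r+1). The left side is (256 z)^b
    <= 256^2 z^((r+1)/r) <= 256^2 q^(r+1), using b <= 2, z >= 1 and z <= q^r. *)
Lemma vinogradov_lower (r K : nat) (a b : R) (D : nat -> R) :
  (r == 2) || (r == 3) -> (K <= 4)%N -> a = b / 2 -> 0 <= b <= r.+1%:R / r%:R ->
  (forall n s k, (0 < k)%N -> (5 <= s)%N -> (s ^ 2 <= n)%N ->
     (2 * (2 ^ k) ^ r + 3 <= nat_pi s)%N ->
     ((2 ^ k) ^ r.+1)%:R <= D n + K%:R * s%:R) ->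
  vinogradov_le (fun n => n%:R `^ a / ln n%:R `^ b) D.
Proof.
move=> r23 K4 aE /andP[b0 br] DK; exists (2 * 256 ^+ 2); first by lra.
near=> n.
have L1 : 1 <= ln (n%:R : R).
  rewrite -[leLHS](expRK 1) ler_ln ?posrE ?expR_gt0 //; near: n.
    exact: nbhs_infty_ger.
  by exists 1%N => // m /= m0; rewrite ltr0n.
have yL : C0 * ln (n%:R : R) ^+ 4 <= Num.sqrt n%:R by near: n; exact: ln_growth.
set y := Num.sqrt n%:R in yL; set L := ln n%:R in L1 yL *.
pose z := y / L / 256.
have [y8 [k [k0 z1 kN zq yq]]] := power_of_two_bounds r23 (erefl y) L1 (erefl z) yL.
have y0 : 0 <= y by rewrite sqrtr_ge0.
have /andP[sy ys] := truncn_itv y0; set s := Num.truncn y in kN sy ys.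
have s5 : (5 <= s)%N.
  by rewrite -(ltr_nat R); move: ys; rewrite -natr1; lra.
have sn : (s ^ 2 <= n)%N.
  rewrite -(ler_nat R) natrX -[leRHS]sqr_sqrtr ?ler0n //.
  by rewrite lerXn2r // nnegrE.
have := DK n s k k0 s5 sn kN; set q := ((2 ^ k) ^ r.+1)%:R in yq * => qD.
have qD2 : q <= 2 * D n.
  have : K%:R * s%:R <= 4 * y by rewrite ler_pM // (ler_nat R K 4).
  by lra.
have -> : n%:R `^ a / L `^ b = (256 * z) `^ b.
  have L0 : 0 < L by lra.
  have -> : 256 * z = y / L by rewrite /z; field; lra.
  rewrite powRM ?invr_ge0 ?(ltW L0) //; congr (_ * _).
    by rewrite /y -powR12_sqrt ?ler0n // -powRrM aE mulrC.
  by rewrite -[L^-1]powR_inv1 ?(ltW L0) // -powRrM mulN1r powRN.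
have b2 : b <= 2.
  apply: (le_trans br); rewrite ler_pdivrMr; last by rewrite ltr0n; case/orP: r23 => /eqP ->.
  by rewrite -natrM ler_nat; case/orP: r23 => /eqP ->.
rewrite powRM; [|exact: ler0n|by lra].
apply: (@le_trans _ _ (256 ^+ 2 * q)); last by nra.
rewrite ler_pM ?powR_ge0 //.
  rewrite -powR_mulrn; last exact: ler0n.
  by apply: ler_powR b2; rewrite (ler_nat R 1 256).
apply: (le_trans (ler_powR z1 br)).
have rr : 0 <= r.+1%:R / r%:R :> R by rewrite divr_ge0.
have -> : q = ((2 ^ k) ^ r)%:R `^ (r.+1%:R / r%:R).
  have r0 : r%:R != 0 :> R by rewrite pnatr_eq0; case/orP: r23 => /eqP ->.
  have u0 : 0 <= (2 ^ k)%:R :> R := ler0n _ _.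
  rewrite /q natrX [in RHS]natrX -(powR_mulrn r.+1 u0) -(powR_mulrn r u0).
  by rewrite -powRrM mulrCA divff // mulr1.
by apply: (ge0_ler_powR rr) => //; rewrite nnegrE ?ler0n //; lra.
Unshelve. all: by end_near. Qed.

End RealBounds.

(** * Assembly of the eight cases *)

Section Assembly.

Variable R : realType.

(** The exponent b equals (r+1)/r in cases (1) to (4); in cases (5) to (8) it is 6/5, below the 4/3
    that r = 3 provides. *)
Lemma vinogradov_lower_Fmax (c : seq nat) (m r : nat) (a b : R) :
  uniq c -> {subset c <= [:: 1; 2; 3; 5]%N} -> admissible c m ->
  (r == 2) && (m <= 5)%N || (r == 3) && (m <= 11)%N ->
  a = b / 2 -> 0 <= b <= r.+1%:R / r%:R ->
  vinogradov_le (fun n => n%:R `^ a / ln n%:R `^ b)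
    (fun n => (Fmax (3 * m) 3 n)%:R - (pi_sum c n)%:R : R).
Proof.
move=> cu cs cm rm ab br; apply: (@vinogradov_lower R r (size c)) => //.
- by case/orP: rm => /andP[/eqP -> _].
- exact: uniq_leq_size cu cs.
move=> n s k k0 s5 sn ks.
rewrite -[leRHS]addrAC lerBrDr -natrM -!natrD ler_nat addnC.
case/orP: rm => /andP[/eqP rE mb]; rewrite rE in ks *.
  exact: Fmax_lower_line.
exact: Fmax_lower_quadrangle.
Qed.

Lemma pi_sum_12 (n : nat) : (pi_sum [:: 1; 2]%N n)%:R =
  (prime_pi (n%:R : R))%:R + (prime_pi (n%:R / 2 : R))%:R :> R.
Proof.
rewrite prime_pi_nat !prime_pi_div // -!natrD.
by rewrite /pi_sum !big_cons big_nil divn1 addn0 ?addnA.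
Qed.

Lemma pi_sum_123 (n : nat) : (pi_sum [:: 1; 2; 3]%N n)%:R =
  (prime_pi (n%:R : R))%:R + (prime_pi (n%:R / 2 : R))%:R
  + (prime_pi (n%:R / 3 : R))%:R :> R.
Proof.
rewrite prime_pi_nat !prime_pi_div // -!natrD.
by rewrite /pi_sum !big_cons big_nil divn1 addn0 ?addnA.
Qed.

Lemma pi_sum_1235 (n : nat) : (pi_sum [:: 1; 2; 3; 5]%N n)%:R =
  (prime_pi (n%:R : R))%:R + (prime_pi (n%:R / 2 : R))%:R
  + (prime_pi (n%:R / 3 : R))%:R + (prime_pi (n%:R / 5 : R))%:R :> R.
Proof.
rewrite prime_pi_nat !prime_pi_div // -!natrD.
by rewrite /pi_sum !big_cons big_nil divn1 addn0 ?addnA.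
Qed.

Lemma vinogradov_upper_Fmax (m w : nat) : (2 < w <= 5)%N -> (exists t, design m w t) ->
  vinogradov_le (fun n => (Fmax (3 * m) 3 n)%:R - (pi_sum (iota 1 w.-1) n)%:R : R)
    (fun n => n%:R `^ (5 / 6)).
Proof. by move=> w35 [t tP]; apply/vinogradov_upper/(Fmax_upper w35 tP). Qed.

Lemma vinogradov_le_eq (X Y X' Y' : nat -> R) : X =1 X' -> Y =1 Y' ->
  vinogradov_le X Y -> vinogradov_le X' Y'.
Proof. by move=> /funext -> /funext ->. Qed.

End Assembly.

Unset Implicit Arguments.

Theorem theorem12 (R : realType) :
  (vinogradov_le
     (fun n : nat => n%:R `^ (3 / 4) / ln n%:R `^ (3 / 2))
     (fun n : nat => (Fmax 12 3 n)%:R - ((prime_pi (n%:R : R))%:R + (prime_pi (n%:R / 2 : R))%:R + (prime_pi (n%:R / 3 : R))%:R) : R) /\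
   vinogradov_le
     (fun n : nat => (Fmax 12 3 n)%:R - ((prime_pi (n%:R : R))%:R + (prime_pi (n%:R / 2 : R))%:R + (prime_pi (n%:R / 3 : R))%:R) : R)
     (fun n : nat => n%:R `^ (5 / 6))) /\
  (vinogradov_le
     (fun n : nat => n%:R `^ (3 / 4) / ln n%:R `^ (3 / 2))
     (fun n : nat => (Fmax 15 3 n)%:R - ((prime_pi (n%:R : R))%:R + (prime_pi (n%:R / 2 : R))%:R + (prime_pi (n%:R / 3 : R))%:R + (prime_pi (n%:R / 5 : R))%:R) : R) /\
   vinogradov_le
     (fun n : nat => (Fmax 15 3 n)%:R - ((prime_pi (n%:R : R))%:R + (prime_pi (n%:R / 2 : R))%:R + (prime_pi (n%:R / 3 : R))%:R + (prime_pi (n%:R / 5 : R))%:R) : R)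
     (fun n : nat => n%:R `^ (5 / 6))) /\
  (vinogradov_le
     (fun n : nat => n%:R `^ (2 / 3) / ln n%:R `^ (4 / 3))
     (fun n : nat => (Fmax 18 3 n)%:R - ((prime_pi (n%:R : R))%:R + (prime_pi (n%:R / 2 : R))%:R) : R) /\
   vinogradov_le
     (fun n : nat => (Fmax 18 3 n)%:R - ((prime_pi (n%:R : R))%:R + (prime_pi (n%:R / 2 : R))%:R) : R)
     (fun n : nat => n%:R `^ (5 / 6))) /\
  (vinogradov_le
     (fun n : nat => n%:R `^ (2 / 3) / ln n%:R `^ (4 / 3))
     (fun n : nat => (Fmax 21 3 n)%:R - ((prime_pi (n%:R : R))%:R + (prime_pi (n%:R / 2 : R))%:R + (prime_pi (n%:R / 3 : R))%:R) : R) /\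
   vinogradov_le
     (fun n : nat => (Fmax 21 3 n)%:R - ((prime_pi (n%:R : R))%:R + (prime_pi (n%:R / 2 : R))%:R + (prime_pi (n%:R / 3 : R))%:R) : R)
     (fun n : nat => n%:R `^ (5 / 6))) /\
  (vinogradov_le
     (fun n : nat => n%:R `^ (3 / 5) / ln n%:R `^ (6 / 5))
     (fun n : nat => (Fmax 24 3 n)%:R - ((prime_pi (n%:R : R))%:R + (prime_pi (n%:R / 2 : R))%:R + (prime_pi (n%:R / 3 : R))%:R) : R) /\
   vinogradov_le
     (fun n : nat => (Fmax 24 3 n)%:R - ((prime_pi (n%:R : R))%:R + (prime_pi (n%:R / 2 : R))%:R + (prime_pi (n%:R / 3 : R))%:R) : R)
     (fun n : nat => n%:R `^ (5 / 6))) /\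
  (vinogradov_le
     (fun n : nat => n%:R `^ (3 / 5) / ln n%:R `^ (6 / 5))
     (fun n : nat => (Fmax 27 3 n)%:R - ((prime_pi (n%:R : R))%:R + (prime_pi (n%:R / 2 : R))%:R) : R) /\
   vinogradov_le
     (fun n : nat => (Fmax 27 3 n)%:R - ((prime_pi (n%:R : R))%:R + (prime_pi (n%:R / 2 : R))%:R) : R)
     (fun n : nat => n%:R `^ (5 / 6))) /\
  (vinogradov_le
     (fun n : nat => n%:R `^ (3 / 5) / ln n%:R `^ (6 / 5))
     (fun n : nat => (Fmax 30 3 n)%:R - ((prime_pi (n%:R : R))%:R + (prime_pi (n%:R / 2 : R))%:R + (prime_pi (n%:R / 3 : R))%:R) : R) /\
   vinogradov_le
     (fun n : nat => (Fmax 30 3 n)%:R - ((prime_pi (n%:R : R))%:R + (prime_pi (n%:R / 2 : R))%:R + (prime_pi (n%:R / 3 : R))%:R) : R)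
     (fun n : nat => n%:R `^ (5 / 6))) /\
  (vinogradov_le
     (fun n : nat => n%:R `^ (3 / 5) / ln n%:R `^ (6 / 5))
     (fun n : nat => (Fmax 33 3 n)%:R - ((prime_pi (n%:R : R))%:R + (prime_pi (n%:R / 2 : R))%:R + (prime_pi (n%:R / 3 : R))%:R) : R) /\
   vinogradov_le
     (fun n : nat => (Fmax 33 3 n)%:R - ((prime_pi (n%:R : R))%:R + (prime_pi (n%:R / 2 : R))%:R + (prime_pi (n%:R / 3 : R))%:R) : R)
     (fun n : nat => n%:R `^ (5 / 6))).
Proof.
have [d4 d6 d7 d8 [d9 d10 d11]] := design_exists.
have eq12 k n : (Fmax k 3 n)%:R - (pi_sum [:: 1; 2]%N n)%:R = (Fmax k 3 n)%:R
    - ((prime_pi (n%:R : R))%:R + (prime_pi (n%:R / 2 : R))%:R) :> R.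
  by rewrite pi_sum_12.
have eq123 k n : (Fmax k 3 n)%:R - (pi_sum [:: 1; 2; 3]%N n)%:R = (Fmax k 3 n)%:R
    - ((prime_pi (n%:R : R))%:R + (prime_pi (n%:R / 2 : R))%:R
       + (prime_pi (n%:R / 3 : R))%:R) :> R.
  by rewrite pi_sum_123.
have eq1235 n : (Fmax 15 3 n)%:R - (pi_sum [:: 1; 2; 3; 5]%N n)%:R = (Fmax 15 3 n)%:R
    - ((prime_pi (n%:R : R))%:R + (prime_pi (n%:R / 2 : R))%:R
       + (prime_pi (n%:R / 3 : R))%:R + (prime_pi (n%:R / 5 : R))%:R) :> R.
  by rewrite pi_sum_1235.
have lower c m r (a b : R) := @vinogradov_lower_Fmax R c m r a b.
have upper m w := @vinogradov_upper_Fmax R m w.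
have s12 : {subset [:: 1; 2]%N <= [:: 1; 2; 3; 5]%N} by apply/allP.
have s123 : {subset [:: 1; 2; 3]%N <= [:: 1; 2; 3; 5]%N} by apply/allP.
split; [|split; [|split; [|split; [|split; [|split; [|split]]]]]]; split.
- apply: vinogradov_le_eq (fun=> erefl) (eq123 12) _.
  by apply: (lower [:: 1; 2; 3]%N 4 2) => //; [exact: admissible_123|lra|lra].
- exact: vinogradov_le_eq (eq123 12) (fun=> erefl) (upper 4 4 isT d4).
- apply: vinogradov_le_eq (fun=> erefl) eq1235 _.
  by apply: (lower [:: 1; 2; 3; 5]%N 5 2) => //; [exact: admissible_1235|lra|lra].
- apply: vinogradov_le_eq eq1235 (fun=> erefl) _.
  exact/vinogradov_upper/Fmax_upper_15.
- apply: vinogradov_le_eq (fun=> erefl) (eq12 18) _.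
  by apply: (lower [:: 1; 2]%N 6 3) => //; [exact: admissible_12|lra|lra].
- exact: vinogradov_le_eq (eq12 18) (fun=> erefl) (upper 6 3 isT d6).
- apply: vinogradov_le_eq (fun=> erefl) (eq123 21) _.
  by apply: (lower [:: 1; 2; 3]%N 7 3) => //; [exact: admissible_123|lra|lra].
- exact: vinogradov_le_eq (eq123 21) (fun=> erefl) (upper 7 4 isT d7).
- apply: vinogradov_le_eq (fun=> erefl) (eq123 24) _.
  by apply: (lower [:: 1; 2; 3]%N 8 3) => //; [exact: admissible_123|lra|lra].
- exact: vinogradov_le_eq (eq123 24) (fun=> erefl) (upper 8 4 isT d8).
- apply: vinogradov_le_eq (fun=> erefl) (eq12 27) _.
  by apply: (lower [:: 1; 2]%N 9 3) => //; [exact: admissible_12|lra|lra].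
- exact: vinogradov_le_eq (eq12 27) (fun=> erefl) (upper 9 3 isT d9).
- apply: vinogradov_le_eq (fun=> erefl) (eq123 30) _.
  by apply: (lower [:: 1; 2; 3]%N 10 3) => //; [exact: admissible_123|lra|lra].
- exact: vinogradov_le_eq (eq123 30) (fun=> erefl) (upper 10 4 isT d10).
- apply: vinogradov_le_eq (fun=> erefl) (eq123 33) _.
  by apply: (lower [:: 1; 2; 3]%N 11 3) => //; [exact: admissible_123|lra|lra].
- exact: vinogradov_le_eq (eq123 33) (fun=> erefl) (upper 11 4 isT d11).
Qed.
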